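(* Let $\Omega\subset\mathbb{R}^n$ be a bounded domain (open and connected) with Lipschitz boundary, and let $\Gamma$ be an open portion of $\partial\Omega$ which is not a portion of a hyperplane. Let $Q>0$ be a constant such that $\|u-u_\Omega\|_{L^2(\Omega)}\le Q\|\nabla u\|_{L^2(\Omega)}$ for every $u\in W^{1,2}(\Omega)$, where $u_\Omega=\frac{1}{|\Omega|}\int_\Omega u$. Let $\gamma:W^{1,2}(\Omega)\to L^2(\Gamma)$ be the trace operator on $\Gamma$ and let $C_\Gamma$ be a constant such that $\|\gamma(u)\|_{L^2(\Gamma)}\le C_\Gamma\|u\|_{W^{1,2}(\Omega)}$ for every $u\in W^{1,2}(\Omega)$. Let $\mathcal{A}$ be the space of affine functions on $\Omega$, let $e:\gamma(\mathcal{A})\to\mathcal{A}$ be the inverse of the (one to one) restriction $\gamma|_{\mathcal{A}}$, let $\pi:L^2(\Gamma)\to\gamma(\mathcal{A})$ be the $L^2(\Gamma)$-orthogonal projection onto $\gamma(\mathcal{A})$, and let $\tau=e\circ\pi:L^2(\Gamma)\to\mathcal{A}$. Then $$\|u-\tau(\gamma(u))\|_{W^{2,2}(\Omega)}\le (1+C_\Gamma\|e\|)(1+Q^2+Q^4)^{\frac12}\|\nabla^2u\|_{L^2(\Omega)}\quad\text{for every }u\in W^{2,2}(\Omega),$$ where $\|e\|$ is the operator norm of $e$ from $\gamma(\mathcal{A})$, with the $L^2(\Gamma)$-norm, to $W^{2,2}(\Omega)$.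
   Context: ''Open portion of $\partial\Omega$'' means a nonempty relatively open subset of $\partial\Omega$; $L^2(\Gamma)$ is taken with respect to the $(n-1)$-dimensional surface measure. $\mathcal{A}=\{u(x)=a+b\cdot x \mid a\in\mathbb{R},\ b\in\mathbb{R}^n\}$. Since $\Gamma$ is not a portion of a hyperplane, the restriction of $\gamma$ to $\mathcal{A}$ is injective, so $e$ is well defined. Norms: $\|u\|_{W^{1,2}(\Omega)}=\left(\int_\Omega u^2+|\nabla u|^2\right)^{1/2}$ and $\|u\|_{W^{2,2}(\Omega)}=\left(\int_\Omega u^2+|\nabla u|^2+|\nabla^2u|^2\right)^{1/2}$, with the Euclidean (Frobenius) norm on vectors and matrices; the constants $Q$ and $C_\Gamma$ exist by the classical Poincaré inequality and trace theorem. Explicitly, $\|e\|^2=\max\left\{\frac{\int_\Omega (a+b\cdot x)^2+|b|^2}{\int_\Gamma(a+b\cdot x)^2} : a\in\mathbb{R},\ b\in\mathbb{R}^n,\ a^2+|b|^2>0\right\}$. *)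

(* Defs.v *)
From HB Require Import structures.
From mathcomp Require Import all_boot all_order all_algebra.
From mathcomp Require Import all_classical all_reals all_analysis.
From mathcomp Require Import zify lra.

Set Implicit Arguments.
Unset Strict Implicit.
Unset Printing Implicit Defensive.

Import Order.TTheory GRing.Theory Num.Theory numFieldNormedType.Exports.

Local Open Scope classical_set_scope.
Local Open Scope ring_scope.

(* The sigma-algebra on row vectors generated by the coordinate maps, as the
   library does for tuples; it is the Borel sigma-algebra. *)
Definition rV_display : measure_display.
Proof. exact: default_measure_display. Qed.

Section measurable_rV.
Context {R : realType} (n : nat).

Definition rV_coord (i : 'I_n) (x : 'rV[R]_n) : measurableTypeR R := x ord0 i.

Let rV_set0 : g_sigma_preimage rV_coord set0.
Proof. exact: sigma_algebra0. Qed.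

Let rV_setC A : g_sigma_preimage rV_coord A -> g_sigma_preimage rV_coord (~` A).
Proof. exact: sigma_algebraC. Qed.

Let rV_bigcup (F : (set 'rV[R]_n)^nat) :
  (forall i, g_sigma_preimage rV_coord (F i)) ->
  g_sigma_preimage rV_coord (\bigcup_i (F i)).
Proof. exact: sigma_algebra_bigcup. Qed.

HB.instance Definition _ := @isMeasurable.Build rV_display 'rV[R]_n
  (g_sigma_preimage rV_coord) rV_set0 rV_setC rV_bigcup.

End measurable_rV.

Section measurable_rV_lemmas.
Context {R : realType} {d : measure_display} {T : measurableType d}.

Lemma measurable_rV_coord n (i : 'I_n) :
  measurable_fun [set: 'rV[R]_n] (rV_coord i).
Proof.
move=> _ Y mY; rewrite setTI; apply: sub_sigma_algebra => /=.
rewrite -bigcup_seq/=; exists i => /=; first by rewrite mem_index_enum.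
by exists Y => //; rewrite setTI.
Qed.

Lemma measurable_fun_rV n (f : T -> 'rV[R]_n) :
  (forall i, measurable_fun [set: T] (rV_coord i \o f)) ->
  measurable_fun [set: T] f.
Proof.
move=> mf _ B mB; rewrite setTI.
suff: g_sigma_preimage (@rV_coord R n) `<=` [set A | measurable (f @^-1` A)].
  exact.
apply: smallest_sub.
  split=> /=.
  - by rewrite preimage_set0.
  - by move=> A mA; rewrite setTD preimage_setC; exact: measurableC.
  - by move=> F mF; rewrite preimage_bigcup; exact: bigcupT_measurable.
rewrite -bigcup_seq => A [i _ [C mC <-]] /=; rewrite setTI -comp_preimage.
by rewrite -[X in measurable X]setTI; exact: mf.
Qed.

End measurable_rV_lemmas.

Section lebesgue_rV.
Context {R : realType}.

Definition rV_cons n (p : measurableTypeR R * 'rV[R]_n) : 'rV[R]_n.+1 :=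
  \row_i if unlift ord0 i is Some j then p.2 ord0 j else p.1.

Definition rV_uncons n (x : 'rV[R]_n.+1) : measurableTypeR R * 'rV[R]_n :=
  (x ord0 ord0, col' ord0 x).

Lemma rV_unconsK n : cancel (@rV_uncons n) (@rV_cons n).
Proof.
move=> x; apply/rowP => j; rewrite mxE.
by case: unliftP => [k|] -> //=; rewrite mxE.
Qed.

Lemma rV_consK n : cancel (@rV_cons n) (@rV_uncons n).
Proof.
case=> t x; rewrite /rV_uncons /rV_cons /= mxE unlift_none; congr pair.
by apply/rowP => j; rewrite !mxE liftK.
Qed.

Lemma measurable_rV_cons n : measurable_fun setT (@rV_cons n).
Proof.
apply: measurable_fun_rV => i; rewrite /rV_coord.
case: (unliftP ord0 i) => [k|] ->.
  rewrite (_ : _ \o _ = rV_coord k \o snd).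
    by apply: measurableT_comp => //; exact: measurable_rV_coord.
  by apply/funext => p /=; rewrite mxE liftK.
by rewrite (_ : _ \o _ = fst)//; apply/funext => p /=; rewrite mxE unlift_none.
Qed.

Lemma measurable_rV_uncons n : measurable_fun setT (@rV_uncons n).
Proof.
apply/measurable_fun_pairP; split; first exact: (@measurable_rV_coord R n.+1 ord0).
apply: measurable_fun_rV => i.
rewrite (_ : _ \o _ = rV_coord (lift ord0 i)); first exact: measurable_rV_coord.
by apply/funext => x /=; rewrite /rV_coord mxE.
Qed.

Section step.
Context (n : nat) (mu : {sigma_finite_measure set 'rV[R]_n -> \bar R}).

Definition lebesgue_rV_step : set 'rV[R]_n.+1 -> \bar R :=
  pushforward (lebesgue_measure \x mu)%E (@rV_cons n).

Let m0 : lebesgue_rV_step set0 = 0%E.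
Proof. by rewrite /lebesgue_rV_step /pushforward preimage_set0 measure0. Qed.

Let m_ge0 A : (0 <= lebesgue_rV_step A)%E.
Proof. by rewrite /lebesgue_rV_step /pushforward measure_ge0. Qed.

Let m_sigma_additive : semi_sigma_additive lebesgue_rV_step.
Proof.
move=> F mF tF mUF; rewrite /lebesgue_rV_step /pushforward preimage_bigcup.
have mV A : measurable A -> measurable (@rV_cons n @^-1` A).
  by move=> mA; rewrite -[X in measurable X]setTI; exact: measurable_rV_cons.
apply: measure_semi_sigma_additive.
- by move=> k; exact: mV.
- apply/trivIsetP => /= i j _ _ ij; rewrite -preimage_setI.
  by move/trivIsetP : tF => /(_ _ _ _ _ ij) ->//; rewrite preimage_set0.
- by rewrite -preimage_bigcup; exact: mV.
Qed.

HB.instance Definition _ := isMeasure.Build _ _ _ lebesgue_rV_step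
  m0 m_ge0 m_sigma_additive.

Let m_sigma_finite : sigma_finite setT lebesgue_rV_step.
Proof.
have /sigma_finiteP[F [TF ndF Foo]] := sigma_finiteT (@lebesgue_measure R).
have /sigma_finiteP[G [TG ndG Goo]] := sigma_finiteT mu.
exists (fun k => @rV_uncons n @^-1` (F k `*` G k)).
  rewrite predeqE => x; split => // _.
  have [i _ Fi] : (\bigcup_k F k) (rV_uncons x).1 by rewrite -TF.
  have [j _ Gj] : (\bigcup_k G k) (rV_uncons x).2 by rewrite -TG.
  exists (maxn i j) => //; split => /=.
  - by move: Fi; exact/subsetPset/ndF/leq_maxl.
  - by move: Gj; exact/subsetPset/ndG/leq_maxr.
move=> k; have [mF Fk] := Foo k; have [mG Gk] := Goo k; split.
  rewrite -[X in measurable X]setTI; apply: measurable_rV_uncons => //.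
  exact: measurableX.
rewrite /lebesgue_rV_step /pushforward -comp_preimage.
have -> : @rV_uncons n \o @rV_cons n = idfun.
  by apply/funext => p; exact: rV_consK.
rewrite preimage_id.
by rewrite product_measure1E// lte_mul_pinfty// ge0_fin_numE.
Qed.

HB.instance Definition _ := Measure_isSigmaFinite.Build _ _ _ lebesgue_rV_step
  m_sigma_finite.

End step.

(* n-dimensional Lebesgue measure: n-fold product of the one-dimensional one. *)
Fixpoint lebesgue_rV n : {sigma_finite_measure set 'rV[R]_n -> \bar R} :=
  match n with
  | 0 => dirac (0 : 'rV[R]_0)
  | n.+1 => lebesgue_rV_step (lebesgue_rV n)
  end.

End lebesgue_rV.

Definition enorm (R : realType) (n : nat) (x : 'rV[R]_n) : R :=
  Num.sqrt (\sum_(i < n) x ord0 i ^+ 2).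

Lemma le_coord_enorm (R : realType) n (x : 'rV[R]_n) i : `|x ord0 i| <= enorm x.
Proof.
rewrite /enorm -sqrtr_sqr ler_wsqrtr// (bigD1 i)//= lerDl sumr_ge0// => j _.
exact: sqr_ge0.
Qed.

Section hausdorff.
Context {R : realType} (m n : nat).
Implicit Types (A B X : set 'rV[R]_n) (F : (set 'rV[R]_n)^nat).
Local Open Scope ereal_scope.

Definition diam A : \bar R :=
  ereal_sup [set (enorm (p.1 - p.2))%:E | p in A `*` A].

(* The factor is omega_m / 2^m, omega_m the volume of the unit ball of R^m, so
   that m-dimensional Hausdorff measure is m-dimensional area; the test on the
   empty set matters for m = 0. *)
Definition hausdorff_gauge A : \bar R :=
  if A == set0 then 0
  else lebesgue_rV m [set y | (enorm y <= 2^-1)%R] * diam A ^+ m.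

Definition hausdorff_cover (delta : R) A F : Prop :=
  A `<=` \bigcup_k F k /\ forall k, diam (F k) <= delta%:E.

Definition hausdorff_pre (delta : R) A : \bar R :=
  ereal_inf [set \sum_(k <oo) hausdorff_gauge (F k)
            | F in hausdorff_cover delta A].

Definition hausdorff_outer A : \bar R :=
  ereal_sup [set hausdorff_pre delta A | delta in [set d : R | (0 < d)%R]].

Lemma diam_ge0 A : A !=set0 -> 0 <= diam A.
Proof.
move=> [x Ax]; apply: (@le_trans _ _ (enorm (x - x))%:E).
  by rewrite lee_fin sqrtr_ge0.
by apply: ereal_sup_ubound; exists (x, x).
Qed.

Lemma diam0 : diam set0 = -oo.
Proof. by rewrite /diam set0X image_set0 ereal_sup0. Qed.

Lemma le_diam A x y i : A x -> A y -> `|x ord0 i - y ord0 i|%:E <= diam A.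
Proof.
move=> Ax Ay; apply: (@le_trans _ _ (enorm (x - y))%:E).
  by rewrite lee_fin (le_trans _ (le_coord_enorm _ i))// !mxE.
by apply: ereal_sup_ubound; exists (x, y).
Qed.

Lemma hausdorff_gauge0 : hausdorff_gauge set0 = 0.
Proof. by rewrite /hausdorff_gauge eqxx. Qed.

Lemma hausdorff_gauge_ge0 A : 0 <= hausdorff_gauge A.
Proof.
rewrite /hausdorff_gauge; case: ifPn => // /set0P A0.
by rewrite mule_ge0// expe_ge0// diam_ge0.
Qed.
Hint Resolve hausdorff_gauge_ge0 : core.

Lemma hausdorff_pre_ge0 delta A : 0 <= hausdorff_pre delta A.
Proof. by apply: le_ereal_inf_tmp => x [F _ <-]; exact: nneseries_ge0. Qed.
Hint Resolve hausdorff_pre_ge0 : core.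

Lemma hausdorff_pre0 delta : hausdorff_pre delta set0 = 0.
Proof.
apply/eqP; rewrite eq_le; apply/andP; split; last exact/hausdorff_pre_ge0.
apply: ereal_inf_lbound; exists (fun=> set0).
  by split => // k; rewrite diam0 leNye.
by rewrite eseries0// => k _ _; rewrite hausdorff_gauge0.
Qed.

Lemma le_hausdorff_pre delta :
  {homo hausdorff_pre delta : A B / A `<=` B >-> A <= B}.
Proof.
move=> A B AB; apply/ereal_inf_le_tmp => x [F [BF dF] <-].
by exists F => //; split => //; exact: subset_trans BF.
Qed.

Lemma hausdorff_pre_delta (d1 d2 : R) A : (d1 <= d2)%R ->
  hausdorff_pre d2 A <= hausdorff_pre d1 A.
Proof.
move=> d12; apply/ereal_inf_le_tmp => x [F [BF dF] <-].
by exists F => //; split => // k; rewrite (le_trans (dF k))// lee_fin.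
Qed.

Lemma hausdorff_pre_sigma_subadditive delta :
  sigma_subadditive (hausdorff_pre delta).
Proof.
set mu := hausdorff_pre delta.
move=> A; have [[i ioo]|] := pselect (exists i, mu (A i) = +oo).
  rewrite (eseries_pinfty _ _ ioo) ?leey// => k _.
  by rewrite -ltNye (lt_le_trans _ (hausdorff_pre_ge0 _ _)).
rewrite -forallNE => Aoo.
suff add2e (e : {posnum R}) :
    mu (\bigcup_n A n) <= \sum_(i <oo) mu (A i) + e%:num%:E.
  by apply/lee_addgt0Pr => _/posnumP[].
rewrite (le_trans _ (epsilon_trick _ _ _))//; last first.
  by move=> k; exact: hausdorff_pre_ge0.
pose P k F := hausdorff_cover delta (A k) F /\
  \sum_(j <oo) hausdorff_gauge (F j) <= mu (A k) + (e%:num / (2 ^ k.+1)%:R)%:E.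
have [G PG] : {G : ((set 'rV[R]_n)^nat)^nat & forall k, P k (G k)}.
  apply: (@choice _ _ P) => k; rewrite /P /mu /hausdorff_pre.
  set S := (X in ereal_inf X); move infS : (ereal_inf S) => iS.
  case: iS infS => [r Sr|Soo|Soo].
  - have en1 : (0 < e%:num / (2 ^ k.+1)%:R)%R by [].
    have /(lb_ereal_inf_adherent en1) : ereal_inf S \is a fin_num by rewrite Sr.
    move=> [x [B cB muBx] xS].
    by exists B; split => //; rewrite muBx -Sr; exact/ltW.
  - by have := Aoo k; rewrite /mu /hausdorff_pre -/S Soo.
  - suff : lbound S 0 by move/le_ereal_inf_tmp; rewrite Soo.
    by move=> /= _ [B _ <-]; exact: nneseries_ge0.
have muG_ge0 x : 0 <= (hausdorff_gauge \o uncurry G) x by exact: hausdorff_gauge_ge0.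
apply: (@le_trans _ _ (\esum_(i in setT) (hausdorff_gauge \o uncurry G) i)).
  rewrite /mu; apply: ereal_inf_lbound => /=.
  have /card_esym/ppcard_eqP[f] := card_nat2.
  exists (uncurry G \o f).
    split => [|i]; last first.
      by rewrite /=; case: (f i) => a b /=; exact: (PG a).1.2.
    apply: (@subset_trans _  (\bigcup_n \bigcup_k G n k)) => [t [i _]|].
      by move=> /((PG i).1.1) -[j _ ?]; exists i => //; exists j.
    move=> t [i _ [j _ Bijt]]; exists (f^-1%FUN (i, j)) => //=.
    by rewrite invK ?inE.
  rewrite -(esum_pred_image (hausdorff_gauge \o uncurry G) _ xpredT)
    ?[fun=> _]set_true//.
  by rewrite image_eq.
rewrite (_ : esum _ _ =
    \sum_(i <oo) \sum_(j <oo ) hausdorff_gauge (G i j)); last first.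
  pose J : nat -> set (nat * nat) := fun i => [set (i, j) | j in setT].
  rewrite (_ : setT = \bigcup_k J k); last first.
    by rewrite predeqE => -[a b]; split => // _; exists a => //; exists b.
  rewrite esum_bigcupT /=; last 2 first.
    - apply/trivIsetP => i j _ _ ij.
      rewrite predeqE => -[k l] /=; split => //= -[] [_] _ [<-{k} _].
      by move=> [m' _] [] /esym/eqP; rewrite (negbTE ij).
    - by move=> /= [k l].
  rewrite -(image_id [set: nat]) -fun_true esum_pred_image//; last first.
    by move=> k _; exact: esum_ge0.
  apply: eq_eseriesr => /= j _.
  rewrite -(esum_pred_image (hausdorff_gauge \o uncurry G) (pair j)
    predT)//=; last first.
    by move=> ? ? _ _; exact: (@can_inj _ _ _ snd).
  by congr esum; rewrite predeqE => -[a b]; split; move=> [i _ <-]; exists i.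
apply: lee_nneseries => [i _ _|i _]; first exact: nneseries_ge0.
exact: (PG i).2.
Qed.

Lemma le_pre_hausdorff delta A : (0 < delta)%R ->
  hausdorff_pre delta A <= hausdorff_outer A.
Proof. by move=> d0; apply: ereal_sup_ubound; exists delta. Qed.

Let outer0 : hausdorff_outer set0 = 0.
Proof.
apply/eqP; rewrite eq_le; apply/andP; split.
  by apply: ge_ereal_sup => _ [d d0 <-]; rewrite hausdorff_pre0.
by rewrite -[leLHS](hausdorff_pre0 1) le_pre_hausdorff.
Qed.

Let outer_ge0 A : 0 <= hausdorff_outer A.
Proof. by rewrite (le_trans (hausdorff_pre_ge0 1 A))// le_pre_hausdorff. Qed.

Let outer_le : {homo hausdorff_outer : A B / A `<=` B >-> A <= B}.
Proof.
move=> A B AB; apply: ge_ereal_sup => _ [d d0 <-].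
by rewrite (le_trans (@le_hausdorff_pre d _ _ AB))// le_pre_hausdorff.
Qed.

Let outer_sigma_subadditive : sigma_subadditive hausdorff_outer.
Proof.
move=> A; apply: ge_ereal_sup => _ [d d0 <-].
rewrite (le_trans (hausdorff_pre_sigma_subadditive _ _))//.
by apply: lee_nneseries => // k _; exact: le_pre_hausdorff.
Qed.

HB.instance Definition _ := isOuterMeasure.Build R 'rV[R]_n hausdorff_outer
  outer0 outer_ge0 outer_le outer_sigma_subadditive.

Lemma hausdorff_outer_sep (i : 'I_n) (r : R) A B : (0 < r)%R ->
  (forall x y, A x -> B y -> (r <= `|x ord0 i - y ord0 i|)%R) ->
  hausdorff_outer A + hausdorff_outer B <= hausdorff_outer (A `|` B).
Proof.
move=> r0 sepAB.
have pre_sep d : (d < r)%R ->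
    hausdorff_pre d A + hausdorff_pre d B <= hausdorff_pre d (A `|` B).
  move=> dr; apply: le_ereal_inf_tmp => _ [F [ABF dF] <-].
  pose FA k := if (F k `&` A) == set0 then set0 else F k.
  pose FB k := if (F k `&` B) == set0 then set0 else F k.
  apply: (@le_trans _ _ (\sum_(k <oo) hausdorff_gauge (FA k) +
      \sum_(k <oo) hausdorff_gauge (FB k))).
    apply: leeD; apply: ereal_inf_lbound.
    - exists FA => //; split => [x Ax|k].
        have [k _ Fkx] := ABF x (or_introl Ax); exists k => //.
        by rewrite /FA ifF//; apply/negbTE/set0P; exists x.
      by rewrite /FA; case: ifP => // _; rewrite diam0 leNye.
    - exists FB => //; split => [x Ax|k].
        have [k _ Fkx] := ABF x (or_intror Ax); exists k => //.
        by rewrite /FB ifF//; apply/negbTE/set0P; exists x.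
      by rewrite /FB; case: ifP => // _; rewrite diam0 leNye.
  rewrite -nneseriesD//.
  apply: lee_nneseries => [k _ _|k _]; first exact: adde_ge0.
  rewrite /FA /FB; case: ifPn => [_|/set0P[x [Fx Ax]]].
    by rewrite hausdorff_gauge0 add0e; case: ifP => // _; rewrite hausdorff_gauge0.
  case: ifPn => [_|/set0P[y [Fy By]]]; first by rewrite hausdorff_gauge0 adde0.
  have := le_trans (le_diam i Fx Fy) (dF k).
  by rewrite lee_fin => /(le_trans (sepAB _ _ Ax By)); rewrite leNgt dr.
have le2 d1 d2 : (0 < d1)%R -> (0 < d2)%R ->
    hausdorff_pre d1 A + hausdorff_pre d2 B <= hausdorff_outer (A `|` B).
  move=> d10 d20; pose d := Num.min (r / 2)%R (Num.min d1 d2).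
  have d0 : (0 < d)%R by rewrite !lt_min d10 d20 divr_gt0.
  apply: (@le_trans _ _ (hausdorff_pre d A + hausdorff_pre d B)).
    apply: leeD; apply: hausdorff_pre_delta.
      by rewrite /d !ge_min lexx !orbT.
    by rewrite /d !ge_min lexx !orbT.
  rewrite (le_trans (pre_sep d _))//; last exact: le_pre_hausdorff.
  by rewrite /d gt_min ltr_pdivrMr// ltr_pMr// ltr1n.
have [->|Uoo] := eqVneq (hausdorff_outer (A `|` B)) +oo; first by rewrite leey.
have Ufin : hausdorff_outer (A `|` B) \is a fin_num.
  by rewrite ge0_fin_numE// ltey.
have Afin : hausdorff_outer A \is a fin_num.
  rewrite ge0_fin_numE// (@le_lt_trans _ _ (hausdorff_outer (A `|` B)))//.
    by apply: outer_le; left.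
  by rewrite ltey.
rewrite -leeBrDl//; apply: ge_ereal_sup => _ [d2 d20 <-].
have Bfin : hausdorff_pre d2 B \is a fin_num.
  rewrite ge0_fin_numE// (@le_lt_trans _ _ (hausdorff_outer (A `|` B)))//.
    by rewrite (le_trans (le_pre_hausdorff B d20))//; apply: outer_le; right.
  by rewrite ltey.
rewrite leeBrDl// -leeBrDr//; apply: ge_ereal_sup => _ [d1 d10 <-].
by rewrite leeBrDr// le2.
Qed.

End hausdorff.

Section hausdorff_measure.
Context {R : realType} (m n : nat).
Implicit Types (A B X : set 'rV[R]_n) (F : (set 'rV[R]_n)^nat).
Local Open Scope ereal_scope.
Local Notation H := (@hausdorff_outer R m n).

Lemma hausdorff_caratheodory_halfspace (i : 'I_n) (a : R) :
  H.-caratheodory [set x | (a < x ord0 i)%R].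
Proof.
set S := [set x | _]; apply: le_caratheodory_measurable => X.
change (H (X `&` S) + H (X `&` ~` S) <= H X).
have [->|Xoo] := eqVneq (H X) +oo; first by rewrite leey.
have XltY : H X < +oo by rewrite ltey.
have leH A B : A `<=` B -> H A <= H B by exact: le_outer_measure.
have H0 A : 0 <= H A by exact: outer_measure_ge0.
pose t k : R := (k.+1%:R^-1)%R.
have t0 k : (0 < t k)%R by rewrite invr_gt0.
have tlt j k : (j < k)%N -> (t k < t j)%R.
  by move=> jk; rewrite ltf_pV2 ?posrE// ltr_nat.
have tle j k : (j <= k)%N -> (t k <= t j)%R.
  by move=> jk; rewrite lef_pV2 ?posrE// ler_nat.
pose Xk k := X `&` [set x | (a + t k < x ord0 i)%R].
pose Rk k := X `&` [set x | (a + t k.+1 < x ord0 i <= a + t k)%R].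
pose U b N := \bigcup_(j in `I_N) Rk (j.*2 + b)%N.
have half b N : \sum_(j < N) H (Rk (j.*2 + b)%N) <= H (U b N).
  elim: N => [|N IH]; first by rewrite big_ord0.
  rewrite big_ord_recr /= (le_trans (leeD2r _ IH))//.
  set k := (N.*2 + b).-1.
  apply: (@le_trans _ _ (H (U b N `|` Rk (N.*2 + b)%N))).
    apply: (@hausdorff_outer_sep _ _ _ i (t k - t k.+1)%R).
      by rewrite subr_gt0 tlt.
    move=> x y -[j /= jN [_ /andP[xj _]]] [_ /andP[_ yN]].
    have kE : k.+1 = (N.*2 + b)%N by lia.
    have jk : (t k <= t (j.*2 + b).+1)%R by apply: tle; lia.
    rewrite -kE in yN; rewrite (le_trans _ (ler_norm _))//; lra.
  apply: leH => x [[j /= jN Rj]|RN]; last by exists N => /=.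
  by exists j => //=; exact: ltnW.
have sum2 N : \sum_(0 <= j < N.*2) H (Rk j) =
    \sum_(j < N) H (Rk (j.*2 + 0)%N) + \sum_(j < N) H (Rk (j.*2 + 1)%N).
  elim: N => [|N IH]; first by rewrite big_nil !big_ord0 adde0.
  rewrite doubleS !big_nat_recr//= IH !big_ord_recr/= addn0 addn1.
  by rewrite -!addeA; congr (_ + _); rewrite addeCA.
have sumR N : \sum_(0 <= j < N) H (Rk j) <= H X + H X.
  apply: (@le_trans _ _ (\sum_(0 <= j < N.*2) H (Rk j))).
    by apply: (@lee_sum_nneg_natr R (H \o Rk) xpredT) => [k _ _|];
      [exact: H0|lia].
  by rewrite sum2 leeD// (le_trans (half _ _))//; apply: leH => x [j _ []].
have sumRoo : \sum_(0 <= j <oo) H (Rk j) < +oo.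
  apply: (@le_lt_trans _ _ (H X + H X)); last by rewrite lte_add_pinfty.
  apply: lime_le; first exact: is_cvg_nneseries.
  by apply: nearW => N; exact: sumR.
have tail k : H (X `&` S) + H (X `&` ~` S) <= H X + \sum_(k <= j <oo) H (Rk j).
  have XS : X `&` S `<=` Xk k `|` \bigcup_(j in ~` `I_k) Rk j.
    move=> x [Xx Sx]; have [?|xk] := ltP (a + t k)%R (x ord0 i); [by left|right].
    have ex : exists j, (a + t j < x ord0 i)%R.
      have /ltr_add_invr[j] : (a < x ord0 i)%R by [].
      by exists j.
    have [j xj jmin] := ex_minnP ex.
    case: j xj jmin => [|j] xj jmin.
      by have := tle 0%N k (leq0n _); lra.
    have xj' : (x ord0 i <= a + t j)%R.
      by rewrite leNgt; apply/negP => /jmin; rewrite ltnn.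
    exists j => /=; last by split => //=; apply/andP.
    apply/negP; rewrite -leqNgt leqNgt; apply/negP => jk.
    by have := tle j.+1 k jk; lra.
  have HXS : H (X `&` S) <= H (Xk k) + \sum_(k <= j <oo) H (Rk j).
    rewrite (le_trans (leH _ _ XS))// (le_trans (outer_measureU2 _ _ _))//.
    by rewrite leeD2l// outer_measure_sigma_subadditive_tail.
  rewrite (le_trans (leeD2r _ HXS))// addeAC leeD2r//.
  apply: (@le_trans _ _ (H (Xk k `|` (X `&` ~` S)))).
    apply: (@hausdorff_outer_sep _ _ _ i (t k)) => // x y [_ /= xk] [_ /negP].
    by rewrite -leNgt => ya; rewrite (le_trans _ (ler_norm _))//; lra.
  by apply: leH => x [[]|[]].
have T0 := nneseries_tail_cvg sumRoo (fun k _ => H0 (Rk k)).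
have T1 : H X + \sum_(k <= j <oo) H (Rk j) @[k --> \oo] --> H X + 0.
  by apply: cvgeD => //; [rewrite fin_num_adde_defl|exact: cvg_cst].
by rewrite -[leRHS]adde0; apply: (cvge_to_ge T1); exact: nearW.
Qed.

Lemma measurable_hausdorff_caratheodory A : measurable A -> H.-caratheodory A.
Proof.
suff: g_sigma_preimage (@rV_coord R n) `<=` H.-caratheodory by exact.
apply: smallest_sub.
  split=> /=.
  - exact: caratheodory_measurable_set0.
  - by move=> B mB; rewrite setTD; exact: caratheodory_measurable_setC.
  - by move=> F mF; exact: caratheodory_measurable_bigcup.
rewrite -bigcup_seq => B [i _ [C mC <-]] /=; rewrite setTI.
suff: @measurable _ (measurableTypeR R) `<=`
  [set C | H.-caratheodory (rV_coord i @^-1` C)] by exact.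
rewrite measurable_realfun.RGenOInfty.measurableE; apply: smallest_sub.
  split=> /=.
  - by rewrite preimage_set0; exact: caratheodory_measurable_set0.
  - move=> D mD; rewrite setTD preimage_setC.
    exact: caratheodory_measurable_setC.
  - move=> F mF; rewrite preimage_bigcup.
    exact: caratheodory_measurable_bigcup.
move=> _ [a ->].
suff -> : [set C0 | H.-caratheodory (rV_coord i @^-1` C0)] `]a, +oo[%classic =
    H.-caratheodory [set x | (a < x ord0 i)%R].
  exact: hausdorff_caratheodory_halfspace.
rewrite [LHS]/=; congr (_.-caratheodory _).
by apply/seteqP; split=> x /=; rewrite in_itv/= andbT.
Qed.

Definition hausdorff_measure : set 'rV[R]_n -> \bar R := @hausdorff_outer R m n.

Let hausdorff_measure0 : hausdorff_measure set0 = 0.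
Proof. exact: outer_measure0. Qed.

Let hausdorff_measure_ge0 A : 0 <= hausdorff_measure A.
Proof. exact: outer_measure_ge0. Qed.

Let hausdorff_measure_sigma_additive : semi_sigma_additive hausdorff_measure.
Proof.
move=> F mF tF mUF; apply: caratheodory_measure_sigma_additive => //.
  by move=> k; exact: measurable_hausdorff_caratheodory.
exact: measurable_hausdorff_caratheodory.
Qed.

HB.instance Definition _ := isMeasure.Build _ _ _ hausdorff_measure
  hausdorff_measure0 hausdorff_measure_ge0 hausdorff_measure_sigma_additive.

End hausdorff_measure.

Section L2.
Context {R : realType} {n : nat}.
Variables (mu : {measure set 'rV[R]_n -> \bar R}) (D : set 'rV[R]_n).
Implicit Types f g : 'rV[R]_n -> R.

Definition L2 : set ('rV[R]_n -> R) :=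
  [set f : 'rV[R]_n -> R | measurable_fun D f /\
    (\int[mu]_(x in D) (f x ^+ 2)%:E < +oo)%E].

Definition L2dot f g : R := \int[mu]_(x in D) (f x * g x).

Definition L2norm f : R := Num.sqrt (\int[mu]_(x in D) f x ^+ 2).

End L2.

Section sobolev.
Context {R : realType} {n : nat}.
Implicit Types (Omega : set 'rV[R]_n) (u v phi : 'rV[R]_n -> R) (i j : 'I_n).
Local Notation leb := (@lebesgue_rV R n).

Definition partial i phi : 'rV[R]_n -> R := 'D_(delta_mx ord0 i) phi.

Definition smooth phi : Prop := forall s : seq 'I_n,
  continuous (foldr partial phi s) /\
  forall i x, derivable (foldr partial phi s) x (delta_mx ord0 i).

Definition test_function Omega phi : Prop :=
  [/\ smooth phi, compact (closure [set x | phi x != 0])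
    & closure [set x | phi x != 0] `<=` Omega].

Definition weak_partial Omega i u v : Prop :=
  forall phi, test_function Omega phi ->
    \int[leb]_(x in Omega) (u x * partial i phi x) =
    - \int[leb]_(x in Omega) (v x * phi x).

(* A weak derivative is unique up to a.e. equality: wpartial is one L2
   representative (0 if there is none). *)
Definition wpartial Omega i u : 'rV[R]_n -> R :=
  xget (cst 0) [set v | L2 leb Omega v /\ weak_partial Omega i u v].

Definition W12 Omega : set ('rV[R]_n -> R) :=
  [set u | L2 leb Omega u /\
    forall i, exists v, L2 leb Omega v /\ weak_partial Omega i u v].

Definition W22 Omega : set ('rV[R]_n -> R) :=
  [set u | W12 Omega u /\ forall i, W12 Omega (wpartial Omega i u)].

Definition grad_sq Omega u (x : 'rV[R]_n) : R :=
  \sum_(i < n) wpartial Omega i u x ^+ 2.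

Definition hess_sq Omega u (x : 'rV[R]_n) : R :=
  \sum_(i < n) \sum_(j < n) wpartial Omega j (wpartial Omega i u) x ^+ 2.

Definition grad_norm Omega u : R :=
  Num.sqrt (\int[leb]_(x in Omega) grad_sq Omega u x).

Definition hess_norm Omega u : R :=
  Num.sqrt (\int[leb]_(x in Omega) hess_sq Omega u x).

Definition W12norm Omega u : R :=
  Num.sqrt (\int[leb]_(x in Omega) (u x ^+ 2 + grad_sq Omega u x)).

Definition W22norm Omega u : R :=
  Num.sqrt (\int[leb]_(x in Omega)
    (u x ^+ 2 + grad_sq Omega u x + hess_sq Omega u x)).

Definition mean Omega u : R :=
  (fine (leb Omega))^-1 * \int[leb]_(x in Omega) u x.

Definition dot (b x : 'rV[R]_n) : R := \sum_(i < n) b ord0 i * x ord0 i.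

Definition affine_fun : set ('rV[R]_n -> R) :=
  [set w | exists (a : R) (b : 'rV[R]_n),
    w = fun x => a + dot b x].

End sobolev.

Section boundary.
Context {R : realType} {n : nat}.
Implicit Types Omega Gamma : set 'rV[R]_n.+1.

Definition boundary Omega : set 'rV[R]_n.+1 := closure Omega `\` Omega°.

(* In the orthogonal coordinates x *m P, Omega is near x0 the strict epigraph of
   a Lipschitz function of all coordinates but the first. *)
Definition lipschitz_boundary Omega : Prop :=
  forall x0, boundary Omega x0 ->
  exists (P : 'M[R]_n.+1) (r K : R) (phi : 'rV[R]_n -> R),
    [/\ P *m P^T = 1%:M, 0 < r,
        forall y z, `|phi y - phi z| <= K * enorm (y - z)
      & forall x, enorm (x - x0) < r ->
          (Omega x <-> phi (col' ord0 (x *m P)) < (x *m P) ord0 ord0)].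

Definition open_portion Omega Gamma : Prop :=
  Gamma !=set0 /\
  exists2 U : set 'rV[R]_n.+1, open U & Gamma = U `&` boundary Omega.

Definition in_hyperplane Gamma : Prop :=
  exists (a : R) (b : 'rV[R]_n.+1), b != 0 /\
    forall x, Gamma x -> a + dot b x = 0.

Definition surface : {measure set 'rV[R]_n.+1 -> \bar R} :=
  @hausdorff_measure R n n.+1.

(* The bounded linear extension of the restriction to Gamma of functions
   continuous up to the boundary; functions represent their a.e. classes. *)
Definition trace_operator Omega Gamma
    (gamma : ('rV[R]_n.+1 -> R) -> ('rV[R]_n.+1 -> R)) : Prop :=
  [/\ forall u, W12 Omega u -> L2 surface Gamma (gamma u),
      forall (c : R) u v, W12 Omega u -> W12 Omega v ->
        ae_eq surface Gamma (gamma (fun x => c * u x + v x))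
          (fun x => c * gamma u x + gamma v x),
      exists C : R, forall u, W12 Omega u ->
        L2norm surface Gamma (gamma u) <= C * W12norm Omega u
    & forall u, W12 Omega u -> {within closure Omega, continuous u} ->
        ae_eq surface Gamma (gamma u) u].

Section affine_trace.
Variables (Omega Gamma : set 'rV[R]_n.+1)
  (gamma : ('rV[R]_n.+1 -> R) -> ('rV[R]_n.+1 -> R)).

Definition affine_traces : set ('rV[R]_n.+1 -> R) :=
  [set g | L2 surface Gamma g /\
    exists2 w, affine_fun w & ae_eq surface Gamma g (gamma w)].

(* gamma is one to one on affine functions and e is its inverse there. *)
Definition affine_trace_inverse
    (e : ('rV[R]_n.+1 -> R) -> ('rV[R]_n.+1 -> R)) : Prop :=
  forall g, affine_traces g -> forall w,
    e g = w <-> affine_fun w /\ ae_eq surface Gamma g (gamma w).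

Definition orthogonal_projection
    (proj : ('rV[R]_n.+1 -> R) -> ('rV[R]_n.+1 -> R)) : Prop :=
  forall g, L2 surface Gamma g ->
    affine_traces (proj g) /\
    forall h, affine_traces h ->
      L2dot surface Gamma (fun x => g x - proj g x) h = 0.

Definition opnorm (e : ('rV[R]_n.+1 -> R) -> ('rV[R]_n.+1 -> R)) : \bar R :=
  ereal_sup [set (W22norm Omega (e g) / L2norm surface Gamma g)%:E
    | g in [set g | affine_traces g /\ L2norm surface Gamma g != 0]].

End affine_trace.

End boundary.

(* Main.v *)
Require Import Defs.
From HB Require Import structures.
From mathcomp Require Import all_boot all_order all_algebra.
From mathcomp Require Import all_classical all_reals all_analysis.
From mathcomp Require Import measurable_realfun ring lra.
Set Implicit Arguments.
Unset Strict Implicit.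
Unset Printing Implicit Defensive.
Import Order.TTheory GRing.Theory Num.Theory numFieldNormedType.Exports.
Local Open Scope classical_set_scope.
Local Open Scope ring_scope.

(* Subtracting from [u] the affine function [w] whose slope is the mean of the
   gradient leaves [v] with [|v|_{W22} <= sqrt (1 + Q^2 + Q^4) |D^2 u|], by the
   Poincare inequality applied to the first derivatives and then to the function.
   As [tau] fixes the traces of affine functions, [u - tau (gamma u)] is
   [v - tau (gamma v)], and [|tau (gamma v)| <= |e| |gamma v| <= |e| C_Gamma |v|].

   Weak derivatives are only representatives, so this needs their uniqueness. It
   is obtained by testing against [bump * f_k], where [f_k] is a product of the
   functions [exp (-1 / (k (x_j - a_j)))] that tends to the indicator of an
   orthant: the density [v * bump] then has zero integral on every orthant. *)

(** * Borel sets of row vectors *)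

(** The detour through [v] is forced: bounding [tau] of a trace costs a full norm of the function,
    and the Hessian does not control that norm for [u] itself. Additivity of [proj] is not among the
    hypotheses; what is needed of it comes from the orthogonality of the residuals and the linearity
    of [gamma] up to null sets. The projection brings no constant of its own, being a contraction of
    L2. The summands of [1 + Q^2 + Q^4] belong to the Hessian, the gradient and the function in
    turn. Second derivatives differentiate a chosen representative, so even the vanishing Hessian of
    an affine function is an almost-everywhere statement, reached by exchanging [wpartial] for an
    a.e. equal function before differentiating again. That affine functions have their slopes as
    weak derivatives rests on translation invariance of [lebesgue_rV], inherited from the line
    through the product construction. *)

Section borel_rV.
Context {R : realType} {n : nat}.
Implicit Types (U A : set 'rV[R]_n) (f : 'rV[R]_n -> R).

Definition ccube (c : 'rV[R]_n) (r : R) : set 'rV[R]_n :=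
  [set x | forall i, `|x ord0 i - c ord0 i| <= r].

(** The clause [0 < r] empties cubes of nonpositive radius in every dimension, 0 included, so that
    radius 0 can pad an enumeration. *)
Definition ocube (c : 'rV[R]_n) (r : R) : set 'rV[R]_n :=
  [set x | 0 < r /\ forall i, `|x ord0 i - c ord0 i| < r].

(** Cubes with rational center and radius [1 / (k + 1)] are enumerated through [unpickle]; a code
    that decodes to nothing, or to a cube not inside [U], receives radius 0. Closed cubes are kept
    inside [U] so that bump functions on them are compactly supported there. *)
Lemma open_bigcup_cube U : open U ->
  exists (c : nat -> 'rV[R]_n) (r : nat -> R),
    (forall k, 0 < r k -> ccube (c k) (r k) `<=` U) /\
    U = \bigcup_k ocube (c k) (r k).
Proof.
move=> oU.
pose cr (p : nat) : 'rV[R]_n * R :=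
  if @unpickle ('rV[rat]_n * nat)%type p is Some qk then
    let c : 'rV[R]_n := map_mx ratr qk.1 in let r : R := qk.2.+1%:R^-1 in
    if `[< ccube c r `<=` U >] then (c, r) else (0, 0)
  else (0, 0).
exists (fun p => (cr p).1), (fun p => (cr p).2); split.
  move=> p; rewrite /cr; case: unpickle => [[q k]|] /=; last by rewrite ltxx.
  by case: asboolP => //= _; rewrite ltxx.
apply/seteqP; split => [x Ux|x [p _]]; last first.
  rewrite /cr; case: unpickle => [[q k]|] /=; last by case; rewrite ltxx.
  case: asboolP => /= [sU|_]; last by case; rewrite ltxx.
  by move=> [_ xq]; apply: sU => i; exact/ltW.
have /nbhs_ballP[e /= e0 eU] := open_nbhs_nbhs (conj oU Ux).
(* The point is within [r] of a rational center and the cube has half-width [r], so the cube stays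
   within [2 * r < e] of the point. *)
have [k ke] : exists k : nat, 2 * k.+1%:R^-1 < e.
  have e2 : 0 < e / 2 by rewrite divr_gt0.
  have /ltr_add_invr[k] := e2; rewrite add0r => ke; exists k.
  by rewrite mulrC -ltr_pdivlMr.
pose r : R := k.+1%:R^-1; have r0 : 0 < r by rewrite invr_gt0.
have [q qP] : {q : 'I_n -> rat & forall i, `|x ord0 i - ratr (q i)| < r}.
  apply: (@choice _ _ (fun i q => `|x ord0 i - ratr q| < r)) => i.
  have /rat_in_itvoo[q] : x ord0 i - r < x ord0 i + r by lra.
  by rewrite in_itv /= => /andP[q1 q2]; exists q; rewrite ltr_norml; lra.
exists (pickle ((\row_i q i), k)) => //.
rewrite /cr pickleK /= -/r asboolT.
  by split => // i; rewrite !mxE.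
move=> y yq; apply: eU; split => // i j; rewrite (ord1 i).
rewrite /ball /=; have := yq j; have := qP j; rewrite !mxE ltr_norml => q1.
by rewrite ler_norml => y1; rewrite ltr_norml; rewrite -/r in ke; lra.
Qed.

Lemma measurable_coord (i : 'I_n) :
  measurable_fun [set: 'rV[R]_n] (fun x : 'rV[R]_n => x ord0 i).
Proof. exact: measurable_rV_coord. Qed.

Lemma measurable_ocube c r : measurable (ocube c r).
Proof.
rewrite (_ : ocube c r = [set x | 0 < r] `&`
  \bigcap_(i in [set: 'I_n]) ((fun x : 'rV[R]_n => x ord0 i) @^-1`
     [set t : measurableTypeR R | `|t - c ord0 i| < r])); last first.
  apply/seteqP; split => x /= [? h]; split => // i; first by move=> _; apply: h.
  exact: h.
apply: measurableI.
  by case: (ltP 0 r) => _; rewrite ?set_true ?set_false.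
apply: fin_bigcap_measurable => // i _.
rewrite -[X in measurable X]setTI; apply: measurable_coord => //.
rewrite (_ : [set t | _] = `]c ord0 i - r, c ord0 i + r[%classic).
  exact: measurable_itv.
by apply/seteqP; split => t /=; rewrite in_itv/= ltr_norml; lra.
Qed.

(** The sigma-algebra is generated by coordinates, not by open sets; the countable union of cubes
    bridges the two. *)
Lemma measurable_open U : open U -> measurable U.
Proof.
move=> /open_bigcup_cube[c [r [_ ->]]].
by apply: bigcupT_measurable => k; exact: measurable_ocube.
Qed.

Lemma measurable_closed U : closed U -> measurable U.
Proof. by move=> /closed_openC/measurable_open/measurableC; rewrite setCK. Qed.

Lemma continuous_measurable f : continuous f -> measurable_fun setT f.
Proof.
move=> cf; apply: (measurability (@RGenOInfty.G R)).
  exact: RGenOInfty.measurableE.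
move=> _ [_ [a ->] <-]; rewrite setTI; apply: measurable_open.
apply: open_comp; first by move=> x _; exact: cf.
exact: interval_open.
Qed.

End borel_rV.

(** * Translation invariance of Lebesgue measure *)

Section lebesgue_translation.
Context {R : realType}.
Local Notation leb1 := (@lebesgue_measure R).

Lemma measurable_shift1 (c : R) :
  measurable_fun [set: measurableTypeR R]
    (fun t : measurableTypeR R => t + c : measurableTypeR R).
Proof. exact: measurable_funD. Qed.

(** The shifted measure gives half-open intervals their length, and this determines Lebesgue
    measure. *)
Lemma lebesgue_measure_shift (c : R) (A : set (measurableTypeR R)) :
  measurable A -> leb1 ((fun t => t + c) @^-1` A) = leb1 A.
Proof.
move=> mA.
pose s : {mfun measurableTypeR R >-> measurableTypeR R} :=
  mfun_Sub (mem_set (measurable_shift1 c)).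
apply/esym.
apply: (@lebesgue_measure_unique R (pushforward leb1 s)) => // _ [[a b]] _ <-.
transitivity (leb1 `](a - c), (b - c)]%classic); last first.
  congr (leb1 _); apply/seteqP; split => x /=; rewrite !in_itv /=; lra.
rewrite !lebesgue_measure_itv /= !lte_fin ltrD2r; case: ifP => // _.
by rewrite -!EFinB; congr (_%:E); lra.
Qed.

Lemma measurable_shift_rV n (c : 'rV[R]_n) :
  measurable_fun setT (fun x : 'rV[R]_n => x + c).
Proof.
apply: measurable_fun_rV => i.
rewrite (_ : _ \o _ = (fun t : measurableTypeR R => t + c ord0 i) \o rV_coord i).
  by apply: measurableT_comp; [exact: measurable_shift1|exact: measurable_rV_coord].
by apply/funext => x; rewrite /rV_coord /= mxE.
Qed.

(** Through [rV_cons] a shift acts separately on the first coordinate and on the rest; by induction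
    the pushed product measure has the right value on rectangles, which characterizes it. *)
Lemma lebesgue_rV_shift n (c : 'rV[R]_n) (A : set 'rV[R]_n) :
  measurable A -> lebesgue_rV n ((fun x => x + c) @^-1` A) = lebesgue_rV n A.
Proof.
elim: n c A => [|n IH] c A mA.
  rewrite (_ : _ @^-1` _ = A)//.
  by apply/seteqP; split => x /=; rewrite [x + c]thinmx0 [x]thinmx0.
rewrite /= /lebesgue_rV_step /pushforward.
pose s (p : measurableTypeR R * 'rV[R]_n) : measurableTypeR R * 'rV[R]_n :=
  (p.1 + c ord0 ord0, p.2 + col' ord0 c).
have ms : measurable_fun setT s.
  apply/measurable_fun_pairP; split.
    exact: (measurableT_comp (measurable_shift1 _)).
  exact: (measurableT_comp (measurable_shift_rV _)).
pose s' : {mfun (measurableTypeR R * 'rV[R]_n)%type >->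
    (measurableTypeR R * 'rV[R]_n)%type} := mfun_Sub (mem_set ms).
rewrite (_ : _ @^-1` _ = s @^-1` (@rV_cons R n @^-1` A)); last first.
  apply/seteqP; split => -[t y] /=; rewrite (_ : rV_cons _ + c = rV_cons (s (t, y)))//;
  by apply/rowP => i; rewrite !mxE; case: unliftP => [j|] -> //=; rewrite !mxE.
apply/esym.
apply: (@product_measure_unique _ _ _ _ _ leb1 (lebesgue_rV n)
  (pushforward (leb1 \x lebesgue_rV n)%E s')).
  move=> B D mB mD.
  transitivity ((leb1 \x lebesgue_rV n)%E
    (((fun t => t + c ord0 ord0) @^-1` B) `*`
     ((fun x => x + col' ord0 c) @^-1` D))); first by [].
  rewrite product_measure1E.
  - congr (_ * _)%E; first exact: lebesgue_measure_shift.
    exact: IH.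
  - by rewrite -[X in measurable X]setTI; exact: measurable_shift1.
  - by rewrite -[X in measurable X]setTI; exact: measurable_shift_rV.
by rewrite -[X in measurable X]setTI; exact: measurable_rV_cons.
Qed.

Lemma integral_lebesgue_rV_shift n (c : 'rV[R]_n) (f : 'rV[R]_n -> \bar R) :
  measurable_fun [set: 'rV[R]_n] f ->
  (lebesgue_rV n).-integrable setT (fun x => f (x + c)) ->
  (\int[lebesgue_rV n]_x f (x + c)%R = \int[lebesgue_rV n]_x f x)%E.
Proof.
move=> mf if_.
have -> : (\int[lebesgue_rV n]_x f x =
    \int[pushforward (lebesgue_rV n) (fun x : 'rV[R]_n => (x + c)%R)]_x f x)%E.
  apply: eq_measure_integral; first exact: measurable_shift_rV.
  by move=> ? A mA _; exact/esym/lebesgue_rV_shift.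
by rewrite integral_pushforward//; exact: measurable_shift_rV.
Qed.

Lemma integrable_lebesgue_rV_shift n (c : 'rV[R]_n) (f : 'rV[R]_n -> \bar R) :
  (lebesgue_rV n).-integrable setT f ->
  (lebesgue_rV n).-integrable setT (fun x => f (x + c)).
Proof.
move=> /integrableP[mf foo]; apply/integrableP; split.
  by apply: (measurableT_comp mf); exact: measurable_shift_rV.
apply: le_lt_trans foo.
have -> : (\int[lebesgue_rV n]_x `|f x| =
    \int[pushforward (lebesgue_rV n) (fun x : 'rV[R]_n => (x + c)%R)]_x `|f x|)%E.
  apply: eq_measure_integral; first exact: measurable_shift_rV.
  by move=> ? A mA _; exact/esym/lebesgue_rV_shift.
rewrite ge0_integral_pushforward//; first exact: measurable_shift_rV.
by apply: measurableT_comp.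
Qed.

Lemma measurable_cube n (M : R) :
  measurable [set x : 'rV[R]_n | forall i, `|x ord0 i| <= M].
Proof.
rewrite (_ : [set _ | _] = \bigcap_(i in [set: 'I_n])
    (rV_coord i @^-1` `[-M, M]%classic)).
  apply: fin_bigcap_measurable => // i _.
  by rewrite -[X in measurable X]setTI; exact: measurable_rV_coord.
apply/seteqP; split => x /= h i.
  by move=> _; rewrite /preimage /rV_coord /= in_itv /= -ler_norml; exact: h.
by have := h i I; rewrite /preimage /rV_coord /= in_itv /= -ler_norml.
Qed.

Lemma lebesgue_rV_cube n (M : R) :
  (lebesgue_rV n [set x : 'rV[R]_n | forall i, `|x ord0 i| <= M]%R < +oo)%E.
Proof.
elim: n => [|n IH].
  rewrite /= diracE; case: (_ \in _) => //; exact: ltry.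
rewrite /= /lebesgue_rV_step /pushforward.
rewrite (_ : _ @^-1` _ =
  `[-M, M]%classic `*` [set x : 'rV[R]_n | forall i, `|x ord0 i| <= M]).
  rewrite product_measure1E//; last exact: measurable_cube.
  rewrite lte_mul_pinfty// ge0_fin_numE//.
  have : (leb1 `[(- M)%R, M]%classic < +oo)%E; last by [].
  by rewrite lebesgue_measure_itv/=; case: ifP => // _; rewrite -EFinD ltry.
apply/seteqP; split => -[t y] /=.
  move=> h; split.
    by have := h ord0; rewrite mxE unlift_none /= in_itv /= -ler_norml.
  by move=> i; have := h (lift ord0 i); rewrite mxE liftK.
move=> [ht hy] i; rewrite mxE; case: unliftP => [j|] _ //=.
by move: ht; rewrite in_itv /= -ler_norml.
Qed.

Lemma le_coord_norm n (x : 'rV[R]_n.+1) i : `|x ord0 i| <= `|x|.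
Proof.
rewrite [leRHS]mx_normrE.
exact: (le_bigmax _ (fun ij : 'I_1 * 'I_n.+1 => `|x ij.1 ij.2|) (ord0, i)).
Qed.

Lemma lebesgue_rV_bounded n (A : set 'rV[R]_n.+1) : measurable A ->
  bounded_set A -> (lebesgue_rV n.+1 A < +oo)%E.
Proof.
move=> mA [M [_ bM]].
have MA x : A x -> `|x| <= M + 1 by apply: bM; rewrite ltrDl.
apply: le_lt_trans (lebesgue_rV_cube n.+1 (M + 1)).
apply: le_measure; rewrite ?inE//.
  exact: measurable_cube.
by move=> x Ax i; rewrite (le_trans (le_coord_norm _ _))// MA.
Qed.

End lebesgue_translation.

(** * The space L2 *)

Section L2_theory.
Context {R : realType} {n : nat}.
Variables (mu : {measure set 'rV[R]_n -> \bar R}) (D : set 'rV[R]_n).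
Hypothesis mD : measurable D.
Implicit Types f g h : 'rV[R]_n -> R.

(** Domination by [f^2 + g^2]. *)
Lemma L2_integrableM f g : L2 mu D f -> L2 mu D g ->
  mu.-integrable D (EFin \o (fun x => f x * g x)).
Proof.
move=> [mf f2] [mg g2].
have int2 h : measurable_fun D h -> (\int[mu]_(x in D) (h x ^+ 2)%:E < +oo)%E ->
    mu.-integrable D (EFin \o (fun x => h x ^+ 2)).
  move=> mh h2; apply/integrableP; split.
    by apply/measurable_EFinP; exact: measurable_funX.
  under eq_integral do rewrite /= ger0_norm ?sqr_ge0//.
  exact: h2.
apply: (@le_integrable _ _ _ _ _ mD _ (EFin \o (fun x => f x ^+ 2 + g x ^+ 2))).
- by apply/measurable_EFinP; exact: measurable_funM.
- move=> x _ /=; rewrite lee_fin normrM [leRHS]ger0_norm ?addr_ge0 ?sqr_ge0//.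
  rewrite -(real_normK (num_real (f x))) -(real_normK (num_real (g x))).
  have := sqr_ge0 (`|f x| - `|g x|).
  have := mulr_ge0 (normr_ge0 (f x)) (normr_ge0 (g x)).
  by rewrite !expr2; nra.
- have := integrableD mD (int2 _ mf f2) (int2 _ mg g2).
  by apply: eq_integrable.
Qed.

Lemma L2_sqr_integrable f : L2 mu D f -> mu.-integrable D (EFin \o (fun x => f x ^+ 2)).
Proof. by move=> Lf; have := L2_integrableM Lf Lf. Qed.

(** The shape [c * f + g] is that of the linearity clause of [trace_operator]; differences are
    obtained with [c = -1], hence the recurring [-1 * g x + f x]. *)
Lemma L2_lin (c : R) f g : L2 mu D f -> L2 mu D g ->
  L2 mu D (fun x => c * f x + g x).
Proof.
move=> Lf Lg; have [mf _] := Lf; have [mg _] := Lg; split.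
  by apply: measurable_funD => //; exact: measurable_funM.
have i1 := integrableZl mD (c ^+ 2) (L2_integrableM Lf Lf).
have i2 := integrableZl mD (2 * c) (L2_integrableM Lf Lg).
have i3 := L2_integrableM Lg Lg.
have := integrableD mD (integrableD mD i1 i2) i3.
move=> /integrableP[_]; apply: le_lt_trans.
rewrite le_eqVlt; apply/orP; left; apply/eqP/eq_integral => x _ /=.
rewrite ger0_norm; last by have := sqr_ge0 (c * f x + g x); nra.
by congr (_%:E); ring.
Qed.

Lemma L2_scale (c : R) f : L2 mu D f -> L2 mu D (fun x => c * f x).
Proof.
move=> Lf; have := L2_lin (c - 1) Lf Lf.
by rewrite (_ : (fun x => _ + _) = (fun x => c * f x))//; apply/funext => x; ring.
Qed.

Lemma L2_sub f g : L2 mu D f -> L2 mu D g -> L2 mu D (fun x => f x - g x).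
Proof.
move=> Lf Lg; have := L2_lin (-1) Lg Lf.
by rewrite (_ : (fun x => _ + _) = (fun x => f x - g x))//; apply/funext => x; ring.
Qed.

Lemma L2_add f g : L2 mu D f -> L2 mu D g -> L2 mu D (fun x => f x + g x).
Proof.
move=> Lf Lg; have := L2_lin 1 Lf Lg.
by rewrite (_ : (fun x => _ + _) = (fun x => f x + g x))//; apply/funext => x; ring.
Qed.

Lemma L2_bounded f (M : R) : (mu D < +oo)%E -> measurable_fun D f ->
  (forall x, D x -> `|f x| <= M) -> L2 mu D f.
Proof.
move=> muD mf fM; split => //.
apply: (@le_lt_trans _ _ (\int[mu]_(x in D) (cst (M ^+ 2)%:E) x)%E).
  apply: ge0_le_integral => //.
  - by move=> x _ /=; rewrite lee_fin sqr_ge0.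
  - by apply/measurable_EFinP; exact: measurable_funX.
  - move=> x Dx /=; rewrite lee_fin -(real_normK (num_real (f x))).
    by rewrite lerXn2r ?nnegrE ?(le_trans (normr_ge0 _) (fM x Dx))// fM.
by rewrite integral_cst// lte_mul_pinfty// ?lee_fin ?sqr_ge0.
Qed.

Lemma L2_cst (c : R) : (mu D < +oo)%E -> L2 mu D (fun=> c).
Proof. by move=> muD; apply: (@L2_bounded _ `|c|). Qed.

Lemma L2_0 : L2 mu D (fun=> 0).
Proof. by split => //; rewrite integral0_eq// => x _; rewrite expr0n. Qed.

Lemma L2dotC f g : L2dot mu D f g = L2dot mu D g f.
Proof. by apply: eq_Rintegral => x _; rewrite mulrC. Qed.

Lemma L2dot_linl (c : R) f g h : L2 mu D f -> L2 mu D g -> L2 mu D h ->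
  L2dot mu D (fun x => c * f x + g x) h = c * L2dot mu D f h + L2dot mu D g h.
Proof.
move=> Lf Lg Lh; rewrite /L2dot -RintegralZl//; last exact: L2_integrableM.
rewrite -RintegralD//; last 2 first.
- have := integrableZl mD c (L2_integrableM Lf Lh).
  by apply: eq_integrable.
- exact: L2_integrableM.
by apply: eq_Rintegral => x _; ring.
Qed.

Lemma L2dot_linr (c : R) f g h : L2 mu D f -> L2 mu D g -> L2 mu D h ->
  L2dot mu D h (fun x => c * f x + g x) = c * L2dot mu D h f + L2dot mu D h g.
Proof. by move=> Lf Lg Lh; rewrite L2dotC L2dot_linl// ![L2dot _ _ h _]L2dotC. Qed.

Lemma L2dot_ge0 f : 0 <= L2dot mu D f f.
Proof. by apply: Rintegral_ge0 => x _; rewrite -expr2 sqr_ge0. Qed.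

Lemma L2normE f : L2norm mu D f = Num.sqrt (L2dot mu D f f).
Proof. by congr Num.sqrt; apply: eq_Rintegral => x _; rewrite expr2. Qed.

Lemma sqr_L2norm f : L2norm mu D f ^+ 2 = L2dot mu D f f.
Proof. by rewrite L2normE sqr_sqrtr// L2dot_ge0. Qed.

Lemma L2dot_ae_eql f g h : L2 mu D f -> L2 mu D g -> L2 mu D h ->
  ae_eq mu D f g -> L2dot mu D f h = L2dot mu D g h.
Proof.
move=> [mf _] [mg _] [mh _] fg; congr fine; apply: ae_eq_integral => //.
- by apply/measurable_EFinP; exact: measurable_funM.
- by apply/measurable_EFinP; exact: measurable_funM.
- by apply: filterS fg => x /[apply] ->.
Qed.

Lemma L2dot_ae_eq f g : L2 mu D f -> L2 mu D g ->
  ae_eq mu D f g -> L2dot mu D f f = L2dot mu D g g.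
Proof.
move=> Lf Lg fg; rewrite (L2dot_ae_eql Lf Lg Lf fg) L2dotC.
exact: L2dot_ae_eql.
Qed.

Lemma L2dot_eq0 f : L2 mu D f -> L2dot mu D f f = 0 -> ae_eq mu D f (fun=> 0).
Proof.
move=> Lf f0; have [mf _] := Lf.
have If := L2_sqr_integrable Lf.
have : (\int[mu]_(x in D) `|(f x ^+ 2)%:E| = 0)%E.
  under eq_integral do rewrite /= ger0_norm ?sqr_ge0//.
  rewrite -[LHS]fineK; last exact: integrable_fin_num If.
  congr (_%:E); rewrite -[RHS]f0; apply: eq_Rintegral => x _; exact: expr2.
move/ae_eq_integral_abs => /(_ mD) h.
have /h : measurable_fun D (fun x => (f x ^+ 2)%:E).
  by apply/measurable_EFinP; exact: measurable_funX.
apply: filterS => x h0 /h0[] /eqP.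
by rewrite sqrf_eq0 => /eqP.
Qed.

(** Integrability and value are proved together so that the lemma can be applied to its own output,
    as the double sum of the Hessian requires. *)
Lemma Rintegral_sum (I : Type) (r : seq I) (F : I -> 'rV[R]_n -> R) :
  (forall i, mu.-integrable D (EFin \o F i)) ->
  mu.-integrable D (EFin \o (fun x => \sum_(i <- r) F i x)) /\
  \int[mu]_(x in D) (\sum_(i <- r) F i x) = \sum_(i <- r) \int[mu]_(x in D) F i x.
Proof.
move=> iF; elim: r => [|i r [IH1 IH2]].
  rewrite big_nil; split; last first.
    under eq_Rintegral do rewrite big_nil.
    by rewrite Rintegral_cst// mul0r.
  apply: (@eq_integrable _ _ _ _ _ mD (cst 0%E)); last exact: integrable0.
  by move=> x _ /=; rewrite big_nil.
have i1 : mu.-integrable D (EFin \o (fun x => \sum_(j <- i :: r) F j x)).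
  have := integrableD mD (iF i) IH1; apply: eq_integrable => //.
  by move=> x _ /=; rewrite big_cons.
split => //; rewrite big_cons -IH2 -RintegralD//.
by apply: eq_Rintegral => x _; rewrite big_cons.
Qed.

End L2_theory.

(** * Minkowski's inequality for finite families of L2 functions *)

Section minkowski.
Context {R : realType}.

(* The discriminant of the nonnegative quadratic [A + 2tB + t^2 C] gives
   Cauchy-Schwarz. *)
Lemma sqrt_quadratic_triangle (A B C : R) : 0 <= A -> 0 <= C ->
  (forall t, 0 <= A + 2 * t * B + t ^+ 2 * C) ->
  Num.sqrt (A + 2 * B + C) <= Num.sqrt A + Num.sqrt C.
Proof.
move=> A0 C0 H.
have BAC : B ^+ 2 <= A * C.
  have [C_eq0|Cn0] := eqVneq C 0.
    have [->|Bn0] := eqVneq B 0; first by rewrite expr0n/= mulr_ge0.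
    (* With [C = 0] and [B] nonzero the expression is linear in [t], and this [t] gives it the value
       -1. *)
    have := H (- (A + 1) / (2 * B)); rewrite C_eq0 mulr0 addr0.
    rewrite (_ : 2 * _ * B = - (A + 1)); last by field.
    by lra.
  have Cp : 0 < C by rewrite lt_def Cn0.
  (* The minimizer of the quadratic. *)
  have := H (- B / C).
  rewrite (_ : _ + _ = (A * C - B ^+ 2) / C); last by field.
  by rewrite pmulr_lge0 ?invr_gt0// subr_ge0.
rewrite -(@ler_pXn2r _ 2)// ?nnegrE ?addr_ge0 ?sqrtr_ge0//.
rewrite sqr_sqrtr; last by have := H 1; rewrite expr1n; lra.
rewrite sqrrD !sqr_sqrtr// -sqrtrM//.
suff : B <= Num.sqrt (A * C) by rewrite mulr2n; lra.
by rewrite (le_trans (ler_norm _))// -sqrtr_sqr ler_wsqrtr.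
Qed.

(** A whole family is treated at once because a Sobolev norm is the root of a sum of squares over
    all derivatives; the cross term is the sum of the dot products. *)
Lemma minkowski_family n (mu : {measure set 'rV[R]_n -> \bar R}) D
    (K : finType) (F G : K -> 'rV[R]_n -> R) : measurable D ->
  (forall k, L2 mu D (F k)) -> (forall k, L2 mu D (G k)) ->
  Num.sqrt (\sum_k L2dot mu D (fun x => F k x + G k x) (fun x => F k x + G k x)) <=
  Num.sqrt (\sum_k L2dot mu D (F k) (F k)) + Num.sqrt (\sum_k L2dot mu D (G k) (G k)).
Proof.
move=> mD LF LG.
have E t : \sum_k L2dot mu D (fun x => t * G k x + F k x) (fun x => t * G k x + F k x) =
    \sum_k L2dot mu D (F k) (F k) + 2 * t * \sum_k L2dot mu D (F k) (G k) +
    t ^+ 2 * \sum_k L2dot mu D (G k) (G k).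
  rewrite !mulr_sumr -!big_split /=; apply: eq_bigr => k _.
  have Lk := L2_lin mD t (LG k) (LF k).
  rewrite L2dot_linl// !L2dot_linr// [L2dot _ _ (G k) (F k)]L2dotC.
  by ring.
have := E 1; rewrite expr1n mul1r mulr1.
rewrite (eq_bigr (fun k => L2dot mu D (fun x => F k x + G k x) (fun x => F k x + G k x))).
  move=> ->; apply: sqrt_quadratic_triangle.
  - by apply: sumr_ge0 => k _; exact: L2dot_ge0.
  - by apply: sumr_ge0 => k _; exact: L2dot_ge0.
  - by move=> t; rewrite -E; apply: sumr_ge0 => k _; exact: L2dot_ge0.
by move=> k _; congr L2dot; apply/funext => x; rewrite mul1r addrC.
Qed.

(** [J] is only a.e. the difference, since the representative that [wpartial] picks for a difference
    need not be the difference of those picked. *)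
Lemma minkowski_family_sub n (mu : {measure set 'rV[R]_n -> \bar R}) D
    (K : finType) (J F G : K -> 'rV[R]_n -> R) : measurable D ->
  (forall k, L2 mu D (J k)) -> (forall k, L2 mu D (F k)) ->
  (forall k, L2 mu D (G k)) ->
  (forall k, ae_eq mu D (J k) (fun x => -1 * G k x + F k x)) ->
  Num.sqrt (\sum_k L2dot mu D (J k) (J k)) <=
  Num.sqrt (\sum_k L2dot mu D (F k) (F k)) + Num.sqrt (\sum_k L2dot mu D (G k) (G k)).
Proof.
move=> mD LJ LF LG JE.
have LN k : L2 mu D (fun x => -1 * G k x) by exact: L2_scale.
have := minkowski_family mD LF LN.
rewrite (eq_bigr (fun k => L2dot mu D (J k) (J k))) => [|k _]; last first.
  apply: L2dot_ae_eq => //; first exact: L2_add.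
  by apply: filterS (JE k) => x h Dx; rewrite h// addrC.
rewrite [X in Num.sqrt _ + Num.sqrt X](eq_bigr (fun k => L2dot mu D (G k) (G k)))//.
by move=> k _; apply: eq_Rintegral => x _; ring.
Qed.

End minkowski.

(** * Integration by parts for affine functions *)

Lemma integrable_scale_indic d (T : measurableType d) (R : realType)
    (mu : {measure set T -> \bar R}) (B : set T) (L : R) :
  measurable B -> (mu B < +oo)%E ->
  mu.-integrable setT (EFin \o (fun x => L * \1_B x)).
Proof.
move=> mB Boo.
apply: (@eq_integrable _ _ _ _ _ measurableT (fun x => L%:E * (\1_B x)%:E)%E) => //.
apply: integrableZl => //; apply/integrableP; split.
  exact/measurable_EFinP/measurable_indic.
under eq_integral do rewrite /= ger0_norm ?indic_ge0//.
by rewrite integral_indic// setIT.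
Qed.

Section compact_support.
Context {R : realType} {n : nat}.
Implicit Types (K : set 'rV[R]_n.+1) (f phi : 'rV[R]_n.+1 -> R).
Local Notation leb := (@lebesgue_rV R n.+1).

Lemma bounded_norm_le K : bounded_set K ->
  exists2 M : R, 0 <= M & forall x, K x -> `|x| <= M.
Proof.
move=> [M [_ bM]]; exists (`|M| + 1); first by rewrite addr_ge0.
by move=> x; apply: bM; rewrite ltr_pwDr// ler_norm.
Qed.

Lemma compact_support_bounded K f : compact K -> continuous f ->
  (forall x, ~ K x -> f x = 0) -> exists2 L : R, 0 <= L & forall x, `|f x| <= L.
Proof.
move=> cK cf f0.
have : compact (f @` K).
  by apply: continuous_compact => //; exact: continuous_subspaceT.
move=> /compact_bounded[M [_ bM]]; exists (`|M| + 1); first by rewrite addr_ge0.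
move=> x; have [Kx|Kx] := pselect (K x).
  by apply: (bM (`|M| + 1)); [rewrite ltr_pwDr// ler_norm|exists x].
by rewrite f0// normr0 addr_ge0.
Qed.

Lemma compact_support_integrable K f : compact K -> continuous f ->
  (forall x, ~ K x -> f x = 0) -> leb.-integrable setT (EFin \o f).
Proof.
move=> cK cf f0.
have [L L0 fL] := compact_support_bounded cK cf f0.
have mf := continuous_measurable cf.
have mK : measurable K by apply: measurable_closed; exact: compact_closed.
have Koo : (leb K < +oo)%E by apply: lebesgue_rV_bounded => //; exact: compact_bounded.
apply: (@le_integrable _ _ _ _ _ _ _ (EFin \o (fun x => L * \1_K x))) => //.
- exact/measurable_EFinP.
- move=> x _ /=; rewrite lee_fin [leRHS]ger0_norm ?mulr_ge0//.
  have [Kx|Kx] := pselect (K x); first by rewrite indicE mem_set// mulr1.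
  by rewrite f0// normr0 mulr_ge0.
- exact: integrable_scale_indic.
Qed.

Lemma partial_eq0 i K f : closed K -> (forall x, ~ K x -> f x = 0) ->
  forall x, ~ K x -> partial i f x = 0.
Proof.
move=> cK f0 x Kx; rewrite /partial.
rewrite (@near_eq_derive _ _ _ f (cst 0) x); first exact: derive_cst.
have : nbhs x (~` K) by apply: open_nbhs_nbhs; split => //; exact: closed_openC.
by apply: filterS => y /f0.
Qed.

(** Restriction to a line, to which the one-variable mean value theorem applies. *)
Lemma derivable_line f (e x : 'rV[R]_n.+1) :
  (forall y, derivable f y e) ->
  forall t : R, is_derive t 1 (fun s => f (x + s *: e)) ('D_e f (x + t *: e)).
Proof.
move=> df t.
set y := x + t *: e; pose g s := f (x + s *: e).
have E : (fun h => h^-1 *: ((g \o shift t) (h *: (1 : R)) - g t)) =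
    (fun h : R => h^-1 *: ((f \o shift y) (h *: e) - f y)).
  rewrite /g /y; apply/funext => h /=; congr (_ *: (f _ - _)).
  by rewrite [h *: 1]mulr1 scalerDl addrCA.
by split; rewrite /derivable /derive E//; exact: df.
Qed.

(* The difference quotients have integral zero by translation invariance. *)
Lemma integral_partial_eq0 i K f : compact K -> continuous f ->
  (forall x, ~ K x -> f x = 0) ->
  (forall x, derivable f x (delta_mx ord0 i)) -> continuous (partial i f) ->
  \int[leb]_x partial i f x = 0.
Proof.
move=> cK cf f0 df cdf; set e : 'rV[R]_n.+1 := delta_mx ord0 i in df *.
have clK : closed K by exact: compact_closed.
have [L L0 dL] := compact_support_bounded cK cdf (partial_eq0 i clK f0).
have [M M0 KM] := bounded_norm_le (compact_bounded cK).
have if_ := compact_support_integrable cK cf f0.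
pose h (k : nat) : R := harmonic k.
have h0 k : 0 < h k by rewrite /h harmonic_gt0.
have h1 k : h k <= 1 by rewrite /h /= invf_le1 ?ler1n.
pose F (k : nat) x := (h k)^-1 * (f (x + h k *: e) - f x).
(* All steps [h k] are at most 1, so a margin of 1 around the support contains the supports of all
   the quotients, and [L * \1_B] dominates them. *)
pose B := [set x : 'rV[R]_n.+1 | forall j, `|x ord0 j| <= M + 1].
have iF k : leb.-integrable setT (EFin \o F k).
  have := integrableB measurableT (integrable_lebesgue_rV_shift (h k *: e) if_) if_.
  by move=> /(integrableZl measurableT (h k)^-1); apply: eq_integrable.
have F0 k : (\int[leb]_x (F k x)%:E = 0)%E.
  have is_ := integrable_lebesgue_rV_shift (h k *: e) if_.
  rewrite (eq_integral (fun x : 'rV[R]_n.+1 =>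
    (h k)^-1%:E * ((EFin \o f) (x + h k *: e)%R - (EFin \o f) x))%E)//.
  rewrite integralZl//; last exact: integrableB.
  rewrite integralB// integral_lebesgue_rV_shift//; last exact: measurable_int if_.
  by rewrite subee ?mule0//; exact: integrable_fin_num.
(* By the mean value theorem on the segment from [x] to [x + h k *: e], a bound on the derivative
   bounds every quotient. *)
have FL k x : `|F k x| <= L.
  rewrite /F normrM normfV (gtr0_norm (h0 k)) mulrC ler_pdivrMr//.
  have [] := @MVT_segment R (fun s => f (x + s *: e))
    (fun s => 'D_e f (x + s *: e)) 0 (h k).
  - exact/ltW.
  - by move=> t _; exact: derivable_line.
  - apply: derivable_within_continuous => t _.
    by have [] := derivable_line x df t.
  move=> t _; rewrite scale0r addr0 subr0 => ->.
  rewrite normrM (gtr0_norm (h0 k)); apply: ler_wpM2r; first exact/ltW.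
  exact: dL.
have FB k x : ~ B x -> F k x = 0.
  move=> /existsNP[j /negP]; rewrite -ltNge => xj.
  rewrite /F !f0 ?subrr ?mulr0// => /KM.
    move/(le_trans (le_coord_norm _ j)); apply/negP; rewrite -ltNge.
    by rewrite (lt_trans _ xj)// ltrDl.
  move/(le_trans (le_coord_norm _ j)); apply/negP; rewrite -ltNge.
  rewrite !mxE /=.
  have : `|h k * (j == i)%:R| <= 1.
    by case: eqP => _; rewrite ?mulr1 ?mulr0 ?normr0// (gtr0_norm (h0 k)).
  have := ler_normB (x ord0 j + h k * (j == i)%:R) (h k * (j == i)%:R).
  rewrite addrK; lra.
have mB : measurable B by exact: measurable_cube.
have := @dominated_cvg _ _ _ leb setT measurableT (fun k => EFin \o F k)
  (EFin \o partial i f) (EFin \o (fun x => L * \1_B x)).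
move=> /(_ _ _ _ _ _) DCT.
have : (\int[leb]_x (F k x)%:E)%E @[k --> \oo] --> (\int[leb]_x (partial i f x)%:E)%E.
  apply: DCT.
  - by move=> k; exact: measurable_int (iF k).
  - move=> x _; apply: cvg_EFin; first exact: nearW.
    have := df x; rewrite /derivable => /cvgr_dnbhsP /(_ h).
    rewrite -/('D_e f x) => D.
    rewrite (_ : fine \o _ = (fun k =>
      (h k)^-1 *: ((f \o shift x) (h k *: e) - f x))); last first.
      by apply/funext => k; rewrite /F /= [_ + x]addrC.
    apply: D; split; first by move=> k; rewrite gt_eqF.
    exact: cvg_harmonic.
  - by [].
  - by apply: integrable_scale_indic => //; exact: lebesgue_rV_cube.
  - move=> k x _ /=; rewrite lee_fin.
    have [Bx|Bx] := pselect (B x); first by rewrite indicE mem_set// mulr1.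
    by rewrite FB// normr0 mulr_ge0.
under eq_fun do rewrite F0.
by rewrite /Rintegral => /(cvg_unique _ (cvg_cst _)) <-.
Qed.

End compact_support.

Section continuous_arith.
Context {R : realType} {T : topologicalType}.
Implicit Types f g : T -> R.

Lemma continuous_funD f g : continuous f -> continuous g ->
  continuous (fun x => f x + g x).
Proof. by move=> cf cg x; apply: cvgD; [exact: cf|exact: cg]. Qed.

Lemma continuous_funM f g : continuous f -> continuous g ->
  continuous (fun x => f x * g x).
Proof. by move=> cf cg x; apply: cvgM; [exact: cf|exact: cg]. Qed.

Lemma continuous_fun_sum (I : Type) (r : seq I) (F : I -> T -> R) :
  (forall i, continuous (F i)) -> continuous (fun x => \sum_(i <- r) F i x).
Proof.
move=> cF; elim: r => [|i r IH].
  by under eq_fun do rewrite big_nil; exact: cst_continuous.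
by under eq_fun do rewrite big_cons; exact: continuous_funD.
Qed.

End continuous_arith.

Section affine_functions.
Context {R : realType} {n : nat}.
Implicit Types (b x y : 'rV[R]_n.+1).

Lemma dot_lin b (h : R) x y : dot b (h *: x + y) = h * dot b x + dot b y.
Proof.
by rewrite /dot mulr_sumr -big_split /=; apply: eq_bigr => i _; rewrite !mxE; ring.
Qed.

Lemma dot_delta b (i : 'I_n.+1) : dot b (delta_mx ord0 i) = b ord0 i.
Proof.
rewrite /dot (bigD1 i)//= !mxE !eqxx mulr1 big1 ?addr0// => j ji.
by rewrite !mxE (negbTE ji) andbF mulr0.
Qed.

Lemma dot_linl (c : R) (b1 b2 x : 'rV[R]_n.+1) :
  dot (c *: b1 + b2) x = c * dot b1 x + dot b2 x.
Proof.
by rewrite /dot mulr_sumr -big_split /=; apply: eq_bigr => i _; rewrite !mxE; ring.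
Qed.

Lemma continuous_affine (a : R) b : continuous (fun x => a + dot b x).
Proof.
apply: continuous_funD; first exact: cst_continuous.
apply: continuous_fun_sum => i; apply: continuous_funM.
  exact: cst_continuous.
exact: coord_continuous.
Qed.

Lemma is_derive_affine (a : R) b (x : 'rV[R]_n.+1) (i : 'I_n.+1) :
  is_derive x (delta_mx ord0 i) (fun y => a + dot b y) (b ord0 i).
Proof.
have E : (fun h : R => h^-1 *: (((fun y => a + dot b y) \o shift x)
    (h *: delta_mx ord0 i) - (a + dot b x))) @ 0^' --> b ord0 i.
  apply: cvg_near_cst; near=> h.
  have h0 : h != 0 by near: h; exact: nbhs_dnbhs_neq.
  rewrite /= dot_lin dot_delta [_ *: _](_ : _ = h^-1 * (h * b ord0 i)).
    by rewrite mulKf.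
  by congr (_ * _); lra.
split; first by apply/cvg_ex; exists (b ord0 i).
exact: cvg_lim E.
Unshelve. all: by end_near. Qed.

Lemma affine_bounded (a : R) b (Omega : set 'rV[R]_n.+1) : bounded_set Omega ->
  exists M, forall x, Omega x -> `|a + dot b x| <= M.
Proof.
move=> /bounded_norm_le[M M0 OM].
exists (`|a| + \sum_i `|b ord0 i| * M) => x Ox.
rewrite (le_trans (ler_normD _ _))// lerD2l /dot.
rewrite (le_trans (ler_norm_sum _ _ _))//; apply: ler_sum => i _.
rewrite normrM ler_wpM2l// (le_trans (le_coord_norm _ _))//; exact: OM.
Qed.

End affine_functions.

Section weak_derivatives.
Context {R : realType} {n : nat}.
Variable Omega : set 'rV[R]_n.+1.
Hypotheses (oO : open Omega) (bO : bounded_set Omega).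
Implicit Types (u v phi : 'rV[R]_n.+1 -> R) (i : 'I_n.+1).
Local Notation leb := (@lebesgue_rV R n.+1).

Let mO : measurable Omega. Proof. exact: measurable_open. Qed.

Lemma bounded_open_finite : (leb Omega < +oo)%E.
Proof. exact: lebesgue_rV_bounded. Qed.

Lemma L2_affine (a : R) (b : 'rV[R]_n.+1) : L2 leb Omega (fun x => a + dot b x).
Proof.
have [M OM] := affine_bounded a b bO.
apply: (@L2_bounded _ _ _ _ _ _ M) => //; first exact: bounded_open_finite.
apply: measurable_funTS; apply: continuous_measurable; exact: continuous_affine.
Qed.

Lemma closure_support_eq0 phi x :
  ~ closure [set x | phi x != 0] x -> phi x = 0.
Proof.
move=> sx; apply/eqP/negPn/negP => px; apply: sx.
exact: subset_closure.
Qed.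

Lemma test_function_continuous phi : test_function Omega phi -> continuous phi.
Proof. by move=> [/(_ [::])[]]. Qed.

Lemma test_function_partial_continuous i phi : test_function Omega phi ->
  continuous (partial i phi).
Proof. by move=> [/(_ [:: i])[]]. Qed.

Lemma test_function_derivable phi i x : test_function Omega phi ->
  derivable phi x (delta_mx ord0 i).
Proof. by move=> [/(_ [::])[]]. Qed.

Lemma L2_compact_support K phi : compact K -> continuous phi ->
  (forall x, ~ K x -> phi x = 0) -> L2 leb Omega phi.
Proof.
move=> cK cphi phi0.
have [L L0 pL] := compact_support_bounded cK cphi phi0.
apply: (@L2_bounded _ _ _ _ _ _ L) => //; first exact: bounded_open_finite.
by apply: measurable_funTS; exact: continuous_measurable.
Qed.

Lemma L2_test_function phi : test_function Omega phi -> L2 leb Omega phi.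
Proof.
move=> tphi; have [_ cK _] := tphi.
apply: (L2_compact_support cK); first exact: test_function_continuous.
exact: closure_support_eq0.
Qed.

Lemma L2_test_function_partial phi i : test_function Omega phi ->
  L2 leb Omega (partial i phi).
Proof.
move=> tphi; have [_ cK _] := tphi.
apply: (L2_compact_support cK); first exact: test_function_partial_continuous.
by apply: partial_eq0; [exact: closed_closure|exact: closure_support_eq0].
Qed.

(** The partial derivative of [w * phi] has zero integral over the whole space, and the product rule
    splits it into the two required terms. Both vanish off the support of [phi], so integrating over
    [Omega] or over the whole space is the same. *)
Lemma weak_partial_affine (a : R) (b : 'rV[R]_n.+1) i :
  weak_partial Omega i (fun x => a + dot b x) (fun=> b ord0 i).
Proof.
move=> phi tphi; have [_ cK KO] := tphi.
set K := closure _ in cK KO.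
set w := fun x => a + dot b x.
have cw : continuous w by exact: continuous_affine.
have cphi := test_function_continuous tphi.
have cdphi := test_function_partial_continuous (i := i) tphi.
have phi0 : forall x, ~ K x -> phi x = 0 by exact: closure_support_eq0.
have dphi0 : forall x, ~ K x -> partial i phi x = 0.
  by apply: partial_eq0 => //; exact: closed_closure.
have dE x : is_derive x (delta_mx ord0 i) (fun y => w y * phi y)
    (w x * partial i phi x + phi x * b ord0 i).
  have d1 := is_derive_affine a b x i.
  have d2 := derivableP (test_function_derivable (i := i) (x := x) tphi).
  exact: is_deriveM d1 d2.
have dE' : partial i (fun y => w y * phi y) =
    fun x => w x * partial i phi x + b ord0 i * phi x.
  by apply/funext => x; rewrite /partial derive_val [phi x * _]mulrC.
have c1 : continuous (fun x => w x * partial i phi x).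
  exact: continuous_funM.
have c2 : continuous (fun x => b ord0 i * phi x).
  by apply: continuous_funM => //; exact: cst_continuous.
have := @integral_partial_eq0 R n i K (fun y => w y * phi y) cK.
rewrite dE' => /(_ _ _ _ _) H.
have {H} : \int[leb]_x (w x * partial i phi x + b ord0 i * phi x) = 0.
  apply: H.
  - exact: continuous_funM.
  - by move=> x Kx; rewrite phi0// mulr0.
  - by move=> x; have [] := dE x.
  - exact: continuous_funD.
have i1 : leb.-integrable setT (EFin \o (fun x => w x * partial i phi x)).
  by apply: (compact_support_integrable cK) => // x Kx; rewrite dphi0// mulr0.
have i2 : leb.-integrable setT (EFin \o (fun x => b ord0 i * phi x)).
  by apply: (compact_support_integrable cK) => // x Kx; rewrite phi0// mulr0.
rewrite RintegralD// => /eqP; rewrite addr_eq0 => /eqP E.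
have restr (g : 'rV[R]_n.+1 -> R) : (forall x, ~ K x -> g x = 0) ->
    \int[leb]_(x in Omega) g x = \int[leb]_x g x.
  move=> g0; rewrite Rintegral_mkcond; apply: eq_Rintegral => x _.
  rewrite patchE; case: ifPn => // /negP xO; rewrite g0// => /KO xO'.
  by apply: xO; rewrite inE.
rewrite !restr//.
- by move=> x Kx; rewrite phi0// mulr0.
- by move=> x Kx; rewrite dphi0// mulr0.
Qed.

Lemma weak_partial_lin (c : R) i u1 u2 v1 v2 :
  L2 leb Omega u1 -> L2 leb Omega u2 -> L2 leb Omega v1 -> L2 leb Omega v2 ->
  weak_partial Omega i u1 v1 -> weak_partial Omega i u2 v2 ->
  weak_partial Omega i (fun x => c * u1 x + u2 x) (fun x => c * v1 x + v2 x).
Proof.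
move=> Lu1 Lu2 Lv1 Lv2 w1 w2 phi tphi.
have Lphi := L2_test_function tphi.
have Ldphi := L2_test_function_partial i tphi.
have := w1 _ tphi; have := w2 _ tphi.
rewrite -!/(L2dot _ _ _ _) => e2 e1.
rewrite !L2dot_linl// e1 e2; ring.
Qed.

(** Used to differentiate a first derivative that is known only up to a null set. *)
Lemma weak_partial_ae_eq i u v u' v' :
  L2 leb Omega u -> L2 leb Omega u' -> L2 leb Omega v -> L2 leb Omega v' ->
  ae_eq leb Omega u u' -> ae_eq leb Omega v v' ->
  weak_partial Omega i u v -> weak_partial Omega i u' v'.
Proof.
move=> Lu Lu' Lv Lv' uu' vv' w phi tphi.
have Lphi := L2_test_function tphi.
have Ldphi := L2_test_function_partial i tphi.
have := w _ tphi; rewrite -!/(L2dot _ _ _ _).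
rewrite (L2dot_ae_eql mO Lu Lu' Ldphi uu').
by rewrite (L2dot_ae_eql mO Lv Lv' Lphi vv').
Qed.

End weak_derivatives.

(** * Bump functions *)

Section flat_function.
Context {R : realType}.
Implicit Types (p q : {poly R}) (t : R).

(** For [p = 1] this is the classical [exp (-1 / t)] extended by 0. Polynomial factors in [1 / t]
    are allowed so that the family is stable under differentiation. *)
Definition flat p t : R := if 0 < t then p.[t^-1] * expR (- t^-1) else 0.

Lemma flat_le0 p t : t <= 0 -> flat p t = 0.
Proof. by rewrite /flat ltNge => ->. Qed.

Lemma flat_gt0 p t : 0 < t -> flat p t = p.[t^-1] * expR (- t^-1).
Proof. by rewrite /flat => ->. Qed.

Lemma flat1_ge0 t : 0 <= flat 1 t.
Proof. by rewrite /flat; case: ifP => // _; rewrite hornerC mul1r expR_ge0. Qed.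

Lemma flat1_le1 t : flat 1 t <= 1.
Proof.
rewrite /flat; case: ifP => // t0; rewrite hornerC mul1r.
by rewrite -expR0 ler_expR oppr_le0 invr_ge0 ltW.
Qed.

Lemma flat1_gt0 t : 0 < t -> 0 < flat 1 t.
Proof. by move=> t0; rewrite flat_gt0// hornerC mul1r expR_gt0. Qed.

(** With [s = 1 / t], the exponential series gives [s^(k+1) / (k+1)! <= exp s]; the exponent [k+1]
    leaves one factor [t] to spare. *)
Lemma exprn_expRN_le (k : nat) t : 0 < t ->
  t^-1 ^+ k * expR (- t^-1) <= k.+1`!%:R * t.
Proof.
move=> t0; set s := t^-1; have s0 : 0 < s by rewrite invr_gt0.
have E : s ^+ k.+1 / k.+1`!%:R <= expR s.
  by apply: le_trans (expR_ge1Dxn k (ltW s0)); rewrite lerDr.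
rewrite expRN ler_pdivrMr ?expR_gt0//.
have kn0 : k.+1`!%:R != 0 :> R by rewrite pnatr_eq0 gtn_eqF// fact_gt0.
rewrite -[leLHS](_ : k.+1`!%:R * t * (s ^+ k.+1 / k.+1`!%:R) = _).
  by rewrite ler_wpM2l// mulr_ge0// ltW.
transitivity ((t * s) * (k.+1`!%:R / k.+1`!%:R) * s ^+ k); first by rewrite exprS; ring.
by rewrite !mulfV ?gt_eqF// !mul1r.
Qed.

(** Applied to ['X * p], this yields differentiability of [flat p] at 0. *)
Lemma flat_lipschitz0 p : exists C, forall t, `|flat p t| <= C * `|t|.
Proof.
exists (\sum_(i < size p) `|p`_i| * i.+1`!%:R) => t.
have [t0|t0] := ltP 0 t; last first.
  rewrite flat_le0// normr0 mulr_ge0// sumr_ge0// => i _.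
rewrite flat_gt0// horner_coef mulr_suml mulr_suml.
rewrite (le_trans (ler_norm_sum _ _ _))//; apply: ler_sum => i _.
rewrite -mulrA normrM -mulrA ler_wpM2l// ger0_norm.
  by rewrite (gtr0_norm t0); exact: exprn_expRN_le.
by rewrite mulr_ge0 ?expR_ge0// exprn_ge0// invr_ge0 ltW.
Qed.

Lemma is_derive_horner p t : is_derive t 1 (horner p) (p^`()).[t].
Proof.
have d : derivable (horner p) t 1 by exact: derivable_horner.
apply: (is_derive_eq (derivableP d)).
by rewrite -derive1E derivE.
Qed.

(** Differentiating [p(1/t) exp(-1/t)] produces the factor [1 / t^2] and the difference [p - p'] at
    [1/t]. *)
Definition dflat p : {poly R} := 'X^2 * (p - p^`()).

Lemma is_derive_flat p t : is_derive t 1 (flat p) (flat (dflat p) t).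
Proof.
have [t0|t0|<-] := ltgtP 0 t.
- have N : \forall x \near t, p.[x^-1] * expR (- x^-1) = flat p x.
    near=> x; rewrite flat_gt0//; near: x; exact: lt_nbhsr.
  apply: (near_eq_is_derive N).
  have dV : is_derive t 1 (fun x : R => x^-1) (- (t^-1 ^+ 2)).
    apply: is_derive_eq; first by apply: is_deriveV; rewrite gt_eqF.
    by rewrite exprVn [_ *: 1]mulr1.
  have d1 : is_derive t 1 (horner p \o (fun x => x^-1)) (p^`().[t^-1] * (- (t^-1 ^+ 2))).
    by apply: is_derive1_comp; exact: is_derive_horner.
  have d2 : is_derive t 1 (expR \o (fun x => - x^-1)) (expR (- t^-1) * (t^-1 ^+ 2)).
    by apply: is_derive1_comp; apply: (is_derive_eq (is_deriveN dV)); rewrite opprK.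
  apply: (is_derive_eq (is_deriveM d1 d2)).
  rewrite flat_gt0// /dflat !hornerE /=.
  by rewrite /GRing.scale /=; ring.
- have N : \forall x \near t, cst 0 x = flat p x.
    near=> x; rewrite flat_le0//; apply: ltW; near: x; exact: lt_nbhsl.
  apply: (near_eq_is_derive N); rewrite flat_le0 ?ltW//; exact: is_derive_cst.
(* At 0 the difference quotient of [flat p] is exactly [flat ('X * p)], which the linear bound sends
   to 0. *)
- have [C HC] := flat_lipschitz0 ('X * p).
  have E : (fun h : R => h^-1 *: ((flat p \o shift 0) (h *: 1) - flat p 0)) @ 0^'
      --> (0 : R).
    apply/cvgrPdist_le => e e0; near=> h.
    have h0 : h != 0 by near: h; exact: nbhs_dnbhs_neq.
    rewrite sub0r normrN /= addr0 [h *: 1]mulr1 [flat p 0]flat_le0// subr0.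
    rewrite (_ : _ *: _ = flat ('X * p) h).
      rewrite (le_trans (HC h))// (@le_trans _ _ (`|C| * `|h|))//.
        by rewrite ler_wpM2r// ler_norm.
      (* The added 1 keeps the divisor positive when [C = 0]. *)
      rewrite (@le_trans _ _ ((`|C| + 1) * `|h|))// ?ler_wpM2r ?lerDl//.
      rewrite mulrC -ler_pdivlMr; last by rewrite ltr_wpDl.
      near: h; apply: dnbhs0_le; rewrite divr_gt0// ltr_wpDl//.
    have [hp|hn] := ltP 0 h; last by rewrite !flat_le0// scaler0.
    by rewrite !flat_gt0// !hornerE /GRing.scale /=; ring.
  rewrite flat_le0//; split; first by apply/cvg_ex; exists 0.
  exact: cvg_lim E.
Unshelve. all: by end_near. Qed.

Lemma continuous_flat p : continuous (flat p).
Proof.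
move=> t; apply: differentiable_continuous; apply/derivable1_diffP.
by have [] := is_derive_flat p t.
Qed.

Lemma flat1_cvg t : flat 1 (k.+1%:R * t) @[k --> \oo] --> ((0 < t)%R%:R : R).
Proof.
have [t0|t0] := ltP 0 t; last first.
  under eq_fun do rewrite flat_le0 ?mulr_ge0_le0//.
  exact: cvg_cst.
rewrite (_ : (fun k => _) = (fun k : nat => expR (- t^-1 * harmonic k))); last first.
  apply/funext => k; rewrite flat_gt0 ?mulr_gt0// hornerC mul1r.
  by rewrite invfM mulNr mulrC.
rewrite -(expR0 R); apply: continuous_cvg; first exact: continuous_expR.
by rewrite -(mulr0 (- t^-1)); apply: cvgMr; exact: cvg_harmonic.
Qed.

End flat_function.

Section flat_algebra.
Context {R : realType} {n : nat}.
Implicit Types (f g : 'rV[R]_n.+1 -> R).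

(* An algebra of functions stable under partial derivatives, hence made of
   smooth functions, and rich enough to contain bump functions. *)
Inductive flat_algebra : ('rV[R]_n.+1 -> R) -> Prop :=
| flat_algebra_flat (p : {poly R}) (al be : R) (j : 'I_n.+1) :
    flat_algebra (fun x => flat p (al * x ord0 j + be))
| flat_algebra_cst (c : R) : flat_algebra (fun=> c)
| flat_algebraD f g : flat_algebra f -> flat_algebra g ->
    flat_algebra (fun x => f x + g x)
| flat_algebraM f g : flat_algebra f -> flat_algebra g ->
    flat_algebra (fun x => f x * g x).

Lemma flat_algebra_prod (I : Type) (r : seq I) (F : I -> 'rV[R]_n.+1 -> R) :
  (forall i, flat_algebra (F i)) -> flat_algebra (fun x => \prod_(i <- r) F i x).
Proof.
move=> FF; elim: r => [|i r IH].
  by under eq_fun do rewrite big_nil; exact: flat_algebra_cst.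
by under eq_fun do rewrite big_cons; exact: flat_algebraM.
Qed.

Lemma flat_algebra_continuous f : flat_algebra f -> continuous f.
Proof.
elim=> [p al be j|c|{}f g _ cf _ cg|{}f g _ cf _ cg].
- move=> x; apply: (@continuous_comp _ _ _
    (fun x : 'rV[R]_n.+1 => al * x ord0 j + be) (flat p)).
    apply: continuous_funD; last exact: cst_continuous.
    by apply: continuous_funM; [exact: cst_continuous|exact: coord_continuous].
  exact: continuous_flat.
- exact: cst_continuous.
- exact: continuous_funD.
- exact: continuous_funM.
Qed.

(** Reduces the partial derivative of a generator of [flat_algebra] to the chain rule in one
    variable. *)
Lemma is_derive_of_line f (x v : 'rV[R]_n.+1) (d : R) :
  is_derive (0 : R) 1 (fun s => f (s *: v + x)) d -> is_derive x v f d.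
Proof.
have E : (fun h => h^-1 *: (((fun s => f (s *: v + x)) \o shift 0) (h *: (1 : R)) -
     f (0 *: v + x))) = (fun h : R => h^-1 *: ((f \o shift x) (h *: v) - f x)).
  by apply/funext => h /=; rewrite [h *: 1]mulr1 addr0 scale0r add0r.
by case=> d1 d2; split; move: d1 d2; rewrite /derivable /derive E.
Qed.

Lemma flat_algebra_derive f i : flat_algebra f ->
  exists2 g, flat_algebra g & forall x, is_derive x (delta_mx ord0 i) f (g x).
Proof.
elim=> [p al be j|c|{}f g Ff [f' Ff' df] Fg [g' Fg' dg]
       |{}f g Ff [f' Ff' df] Fg [g' Fg' dg]].
- exists (fun x => flat (dflat p) (al * x ord0 j + be) * (al * (j == i)%:R)).
    by apply: flat_algebraM; [exact: flat_algebra_flat|exact: flat_algebra_cst].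
  move=> x; apply: is_derive_of_line.
  pose l (s : R) := al * (s * (j == i)%:R + x ord0 j) + be.
  rewrite (_ : (fun s => _) = flat p \o l); last first.
    by apply/funext => s; rewrite /l /= !mxE /=.
  have l0 : l 0 = al * x ord0 j + be by rewrite /l mul0r add0r.
  rewrite -l0; apply: is_derive1_comp; first exact: is_derive_flat.
  rewrite (_ : l = (fun s => (al * (j == i)%:R) *: s + (al * x ord0 j + be))); last first.
    by apply/funext => s; rewrite /l /GRing.scale /=; ring.
  have d1 : is_derive (0 : R) 1 ((al * (j == i)%:R) \*: (@id R)) ((al * (j == i)%:R) *: 1).
    by apply: is_deriveZ; exact: is_derive_id.
  have d2 : is_derive (0 : R) 1 (cst (al * x ord0 j + be) : R -> R) 0.
    exact: is_derive_cst.
  have := is_deriveD d1 d2.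
  by rewrite addr0 [_ *: 1]mulr1.
- exists (fun=> 0); first exact: flat_algebra_cst.
  by move=> x; exact: is_derive_cst.
- exists (fun x => f' x + g' x); first exact: flat_algebraD.
  by move=> x; have := is_deriveD (df x) (dg x).
- exists (fun x => f x * g' x + g x * f' x).
    by apply: flat_algebraD; exact: flat_algebraM.
  by move=> x; have := is_deriveM (df x) (dg x).
Qed.

Lemma flat_algebra_smooth f : flat_algebra f -> smooth f.
Proof.
move=> Ff s.
have Fs : flat_algebra (foldr partial f s).
  elim: s => //= i s IH.
  have [g Fg dg] := flat_algebra_derive i IH.
  rewrite (_ : partial i _ = g)//; apply/funext => x.
  by rewrite /partial; have [_ ->] := dg x.
split; first exact: flat_algebra_continuous.
move=> i x; have [g _ dg] := flat_algebra_derive i Fs.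
by have [] := dg x.
Qed.

(* Positive exactly on the open cube of center [c] and radius [r]. *)
Definition bump (c : 'rV[R]_n.+1) (r : R) (x : 'rV[R]_n.+1) : R :=
  \prod_j (flat 1 (1 * x ord0 j + (r - c ord0 j)) *
           flat 1 (-1 * x ord0 j + (r + c ord0 j))).

(** The arguments are expanded, as in [bump], so that every factor is literally a generator of
    [flat_algebra]. *)
Definition soft_orthant (a : 'rV[R]_n.+1) (k : nat) (x : 'rV[R]_n.+1) : R :=
  \prod_j flat 1 (k.+1%:R * x ord0 j + - (k.+1%:R * a ord0 j)).

Lemma flat_algebra_bump c r : flat_algebra (bump c r).
Proof.
apply: flat_algebra_prod => j.
by apply: flat_algebraM; exact: flat_algebra_flat.
Qed.

Lemma flat_algebra_soft_orthant a k : flat_algebra (soft_orthant a k).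
Proof. by apply: flat_algebra_prod => j; exact: flat_algebra_flat. Qed.

Lemma prod_itv01 (F : 'I_n.+1 -> R) : (forall j, 0 <= F j <= 1) ->
  0 <= \prod_j F j <= 1.
Proof.
move=> F01; elim/big_ind : _ => [|x y /andP[x0 x1] /andP[y0 y1]|//].
  by rewrite ler01 lexx.
by rewrite mulr_ge0//= mulr_ile1.
Qed.

Lemma soft_orthant01 a k x : 0 <= soft_orthant a k x <= 1.
Proof. by apply: prod_itv01 => j; rewrite flat1_ge0 flat1_le1. Qed.

Lemma bump_gt0 c r x : ocube c r x -> 0 < bump c r x.
Proof.
move=> [_ xc]; apply: prodr_gt0 => j _.
have := xc j; rewrite ltr_norml => /andP[x1 x2].
by rewrite mulr_gt0// flat1_gt0//; lra.
Qed.

Lemma bump_eq0 c r x : ~ ccube c r x -> bump c r x = 0.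
Proof.
move=> /existsNP[j /negP]; rewrite -ltNge => xj.
rewrite /bump (bigD1 j)//=.
have [xc|xc] := leP (x ord0 j) (c ord0 j).
  rewrite flat_le0 ?mul0r//; move: xj; rewrite ler0_norm; lra.
rewrite [X in _ * X * _]flat_le0 ?mulr0 ?mul0r//.
by move: xj; rewrite gtr0_norm; lra.
Qed.

Lemma ccube_closed (c : 'rV[R]_n.+1) r : closed (ccube c r).
Proof.
rewrite (_ : ccube c r = \bigcap_(j in [set: 'I_n.+1])
    ((fun x : 'rV[R]_n.+1 => x ord0 j) @^-1` `[c ord0 j - r, c ord0 j + r]%classic)).
  apply: closed_bigI => j _; apply: closed_comp; last exact: interval_closed.
  by move=> x _; exact: coord_continuous.
apply/seteqP; split => x /= h j.
  by move=> _; rewrite /preimage /= in_itv /=; have := h j; rewrite ler_norml; lra.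
by have := h j I; rewrite /preimage /= in_itv /= ler_norml; lra.
Qed.

Lemma ccube_compact (c : 'rV[R]_n.+1) r : compact (ccube c r).
Proof.
apply: bounded_closed_compact; last exact: ccube_closed.
exists (`|r| + `|c|); split; first exact: num_real.
move=> M rM x xc; change (`|x| <= M); rewrite [leLHS]mx_normrE; apply: bigmax_le.
  by rewrite (le_trans _ (ltW rM))// addr_ge0.
move=> [i j] _ /=; rewrite (ord1 i) (le_trans _ (ltW rM))//.
have := xc j; have := ler_norm r; have := le_coord_norm c j.
have := ler_normD (x ord0 j - c ord0 j) (c ord0 j); rewrite subrK; lra.
Qed.

Lemma test_function_bump (Omega : set 'rV[R]_n.+1) c r f :
  ccube c r `<=` Omega -> flat_algebra f ->
  test_function Omega (fun x => bump c r x * f x).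
Proof.
move=> cO Ff; set g := fun x => _.
have sub : closure [set x | g x != 0] `<=` ccube c r.
  have -> : ccube c r = closure (ccube c r) by exact/closure_id/ccube_closed.
  apply: closure_subset => x /= gx; apply: contrapT => /bump_eq0 bx.
  by move: gx; rewrite /g bx mul0r eqxx.
split.
- by apply: flat_algebra_smooth; apply: flat_algebraM => //; exact: flat_algebra_bump.
- by apply: (subclosed_compact _ (@ccube_compact c r)) => //; exact: closed_closure.
- exact: subset_trans cO.
Qed.

End flat_algebra.

(** * Uniqueness of weak derivatives *)

Section orthants.
Context {R : realType} {n : nat}.

Definition orthant (a : 'rV[R]_n) : set 'rV[R]_n :=
  [set x | forall j, a ord0 j < x ord0 j].

Lemma measurable_orthant a : measurable (orthant a).
Proof.
rewrite (_ : orthant a = \bigcap_(j in [set: 'I_n])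
    (rV_coord j @^-1` `]a ord0 j, +oo[%classic)).
  apply: fin_bigcap_measurable => // i _.
  by rewrite -[X in measurable X]setTI; exact: measurable_rV_coord.
apply/seteqP; split => x h j.
  by move=> _; rewrite /preimage /rV_coord /= in_itv /= andbT.
by have := h j I; rewrite /preimage /rV_coord /= in_itv /= andbT.
Qed.

Lemma orthantI a b : orthant a `&` orthant b =
  orthant (\row_j Num.max (a ord0 j) (b ord0 j)).
Proof.
apply/seteqP; split => x.
  by move=> [xa xb] j; rewrite mxE gt_max xa xb.
by move=> h; split => j; have := h j; rewrite mxE gt_max => /andP[].
Qed.

Lemma measurable_orthantE :
  @measurable _ 'rV[R]_n = <<s [set orthant a | a in setT] >>.
Proof.
apply/seteqP; split; last first.
  apply: smallest_sub; first exact: sigma_algebra_measurable.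
  by move=> _ [a _ <-]; exact: measurable_orthant.
set S := <<s _ >>.
have sS : sigma_algebra setT S by exact: smallest_sigma_algebra.
have [S0 SC SU] := sS.
have {}SC A : S A -> S (~` A) by move=> /SC; rewrite setTD.
apply: smallest_sub => //.
rewrite -bigcup_seq => B [i _ [C mC <-]] /=; rewrite setTI.
suff: @measurable _ (measurableTypeR R) `<=`
  [set C | S (rV_coord i @^-1` C)] by exact.
rewrite RGenOInfty.measurableE; apply: smallest_sub.
  split=> /=.
  - by rewrite preimage_set0.
  - by move=> E mE; rewrite setTD preimage_setC; exact: SC.
  - by move=> F mF; rewrite preimage_bigcup; exact: SU.
move=> _ [t ->] /=.
(* The half-space where coordinate [i] exceeds [t] is the union of the orthants whose corner is [t]
   in coordinate [i] and [-k] in the others. *)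
pose a (k : nat) : 'rV[R]_n := \row_j if j == i then t else - k%:R.
rewrite (_ : _ @^-1` _ = \bigcup_k orthant (a k)).
  by apply: SU => k; apply: sub_sigma_algebra; exists (a k).
apply/seteqP; split => x.
  rewrite /preimage /rV_coord /= in_itv /= andbT => tx.
  (* Larger than every [- x ord0 j] at once. *)
  pose k := (Num.truncn (\sum_j `|x ord0 j|)).+1.
  exists k => // j; rewrite mxE; case: eqP => [->//|_].
  rewrite ltrNl (@le_lt_trans _ _ (\sum_j `|x ord0 j|))// ?truncnS_gt//.
  rewrite (bigD1 j)//= (le_trans (ler_norm _))// normrN lerDl sumr_ge0//.
move=> [k _ /(_ i)]; rewrite mxE eqxx => tx.
by rewrite /preimage /rV_coord /= in_itv /= andbT.
Qed.

(** Orthants are closed under intersection and generate the sigma-algebra, so Dynkin induction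
    spreads the vanishing to all measurable sets. The zero integral over [D] serves the step from a
    set to its complement. *)
Lemma integral_orthant_ae0 (mu : {measure set 'rV[R]_n -> \bar R})
    (D : set 'rV[R]_n) (G : 'rV[R]_n -> R) : measurable D ->
  mu.-integrable D (EFin \o G) ->
  (\int[mu]_(x in D) (G x)%:E = 0)%E ->
  (forall a, \int[mu]_(x in D `&` orthant a) (G x)%:E = 0)%E ->
  ae_eq mu D G (fun=> 0).
Proof.
move=> mD iG G0 Ga.
have iS (S : set 'rV[R]_n) : measurable S -> mu.-integrable (D `&` S) (EFin \o G).
  by move=> mS; apply: integrableS iG => //; exact: measurableI.
have H (S : set 'rV[R]_n) : measurable S -> (\int[mu]_(x in D `&` S) (G x)%:E = 0)%E.
  move=> mS.
  apply: (@dynkin_induction _ _ [set orthant a | a in setT]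
    (fun S => (\int[mu]_(x in D `&` S) (G x)%:E = 0)%E)).
  - exact: measurable_orthantE.
  - move=> _ _ [a _ <-] [b _ <-]; rewrite orthantI.
    by exists (\row_j Num.max (a ord0 j) (b ord0 j)).
  - by rewrite setIT.
  - by move=> _ [a _ <-]; exact: Ga.
  - move=> {}S {}mS GS.
    have := G0; rewrite -{1}(setIT D) -(setUv S) setIUr integral_setU; first last.
    - rewrite disj_set2E; apply/eqP/seteqP; split => // x [[_ Sx] [_ Sx']].
      exact: Sx'.
    - rewrite -setIUr setUv setIT; exact: measurable_int iG.
    - by apply: measurableI => //; exact: measurableC.
    - exact: measurableI.
    by rewrite GS add0e.
  - move=> F mF tF GF; rewrite setI_bigcupr integral_bigcup.
    + by rewrite eseries0// => i _ _; exact: GF.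
    + exact: trivIset_setIl.
    + by move=> k; exact: measurableI.
    + by rewrite -setI_bigcupr; apply: iS; exact: bigcupT_measurable.
  - by rewrite -measurable_orthantE.
have : ae_eq mu D (EFin \o G) (cst 0%E).
  apply: integral_ae_eq => // E ED mE; rewrite integral0.
  by rewrite -(setIidr ED); exact: H.
by apply: filterS => x h /h[].
Qed.

End orthants.

Section fundamental_lemma.
Context {R : realType} {n : nat}.
Variable Omega : set 'rV[R]_n.+1.
Hypotheses (oO : open Omega) (bO : bounded_set Omega).
Local Notation leb := (@lebesgue_rV R n.+1).

Let mO : measurable Omega. Proof. exact: measurable_open. Qed.

Lemma soft_orthant_cvg (a x : 'rV[R]_n.+1) :
  soft_orthant a k x @[k --> \oo] --> (\1_(orthant a) x : R).
Proof.
rewrite (_ : \1_(orthant a) x = \prod_j (a ord0 j < x ord0 j)%R%:R); last first.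
  rewrite indicE; case: (boolP (x \in _)) => [|xa].
    by rewrite inE => xa; rewrite big1// => j _; rewrite xa.
  have [j xj] : exists j, ~ (a ord0 j < x ord0 j).
    by apply/existsNP => h; move: xa; rewrite notin_setE; apply.
  by rewrite (bigD1 j)//=; move/negP/negbTE: xj => ->; rewrite mul0r.
rewrite /soft_orthant; elim: (index_enum _) => [|j r IH].
  by under eq_fun do rewrite big_nil; rewrite big_nil; exact: cvg_cst.
under eq_fun do rewrite big_cons; rewrite big_cons; apply: cvgM => //.
under eq_fun do rewrite -mulrBr.
rewrite -subr_gt0; exact: flat1_cvg.
Qed.

Lemma ae_eq0_cube (v : 'rV[R]_n.+1 -> R) (c : 'rV[R]_n.+1) (r : R) :
  L2 leb Omega v ->
  (forall phi, test_function Omega phi ->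
     \int[leb]_(x in Omega) (v x * phi x) = 0) ->
  ccube c r `<=` Omega ->
  ae_eq leb Omega (fun x => v x * bump c r x) (fun=> 0).
Proof.
move=> Lv v0 cO.
have Lb f : flat_algebra f -> L2 leb Omega (fun x => bump c r x * f x).
  by move=> Ff; apply: L2_test_function => //; exact: test_function_bump.
have iv f : flat_algebra f ->
    leb.-integrable Omega (EFin \o (fun x => v x * (bump c r x * f x))).
  by move=> Ff; apply: L2_integrableM => //; exact: Lb.
have v0' f : flat_algebra f ->
    (\int[leb]_(x in Omega) (v x * (bump c r x * f x))%:E = 0)%E.
  move=> Ff; rewrite -[LHS]fineK; last exact: integrable_fin_num (iv f Ff).
  by rewrite [fine _](v0 _ (test_function_bump cO Ff)).
have iG : leb.-integrable Omega (EFin \o (fun x => v x * bump c r x)).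
  by have := iv _ (flat_algebra_cst 1); apply: eq_integrable => // x _ /=; rewrite mulr1.
apply: integral_orthant_ae0 => //.
  rewrite -[RHS](v0' _ (flat_algebra_cst 1)).
  by apply: eq_integral => x _; rewrite mulr1.
move=> a.
have C : (\int[leb]_(x in Omega) (v x * (bump c r x * soft_orthant a k x))%:E)%E
    @[k --> \oo] --> (\int[leb]_(x in Omega) (v x * bump c r x * \1_(orthant a) x)%:E)%E.
  (* Soft orthants take values between 0 and 1, so the absolute value of [v * bump] dominates. *)
  apply: (@dominated_cvg _ _ _ leb Omega mO
    (fun k x => (v x * (bump c r x * soft_orthant a k x))%:E)
    (fun x => (v x * bump c r x * \1_(orthant a) x)%:E)
    (fun x => `|(v x * bump c r x)%:E|%E)).
  - by move=> k; exact: measurable_int (iv _ (flat_algebra_soft_orthant a k)).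
  - move=> x _; apply: cvg_EFin; first exact: nearW.
    rewrite (_ : fine \o _ = (fun k => v x * bump c r x * soft_orthant a k x)).
      by apply: cvgMr; exact: soft_orthant_cvg.
    by apply/funext => k /=; rewrite mulrA.
  - by [].
  - exact: integrable_abse iG.
  - move=> k x _; rewrite !abse_EFin lee_fin mulrA normrM ler_piMr//.
    by have /andP[s0 s1] := soft_orthant01 a k x; rewrite ger0_norm.
have : (\int[leb]_(x in Omega) (v x * bump c r x * \1_(orthant a) x)%:E = 0)%E.
  move: C; under eq_fun do rewrite (v0' _ (flat_algebra_soft_orthant a _)).
  by move=> /(cvg_unique _ (cvg_cst _)) <-.
move=> <-; rewrite integral_mkcondr; apply: eq_integral => x _.
rewrite patchE indicE; case: ifPn => _; first by rewrite mulr1.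
by rewrite mulr0.
Qed.

Lemma fundamental_lemma (v : 'rV[R]_n.+1 -> R) : L2 leb Omega v ->
  (forall phi, test_function Omega phi ->
     \int[leb]_(x in Omega) (v x * phi x) = 0) ->
  ae_eq leb Omega v (fun=> 0).
Proof.
move=> Lv v0; have [c [r [cO OE]]] := open_bigcup_cube oO.
have H k : {ae leb, forall x, ocube (c k) (r k) x -> v x = 0}.
  have [rk|rk] := ltP 0 (r k); last first.
    by apply: nearW => x [] /lt_le_trans/(_ rk); rewrite ltxx.
  have := ae_eq0_cube Lv v0 (cO k rk).
  apply: filterS => x h xk.
  have Ox : Omega x by rewrite OE; exists k.
  (* On the open cube the bump is positive and can be cancelled. *)
  have /eqP := h Ox; rewrite mulf_eq0 (gt_eqF (bump_gt0 xk)) orbF.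
  by move/eqP.
have := ae_foralln H; apply: filterS => x h Ox.
by move: Ox; rewrite OE => -[k _]; exact: h.
Qed.

End fundamental_lemma.

(** * Linearity and norms in W12 and W22 *)

Section sobolev_linear.
Context {R : realType} {n : nat}.
Variable Omega : set 'rV[R]_n.+1.
Hypotheses (oO : open Omega) (bO : bounded_set Omega).
Implicit Types (u v w : 'rV[R]_n.+1 -> R) (i j : 'I_n.+1).
Local Notation leb := (@lebesgue_rV R n.+1).
Local Notation nsq u := (L2dot leb Omega u u).

Let mO : measurable Omega. Proof. exact: measurable_open. Qed.

(** True for every [u]: without a weak derivative, [wpartial] falls back on the zero function. *)
Lemma L2_wpartial i u : L2 leb Omega (wpartial Omega i u).
Proof.
rewrite /wpartial; case: xgetP => [v _ []//|_].
exact: L2_0.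
Qed.

Lemma weak_partial_wpartial i u v : L2 leb Omega v -> weak_partial Omega i u v ->
  weak_partial Omega i u (wpartial Omega i u).
Proof.
by move=> Lv uv; rewrite /wpartial; case: xgetP => [v' _ []//|/(_ v)[]].
Qed.

Lemma weak_partial_unique i u v1 v2 : L2 leb Omega v1 -> L2 leb Omega v2 ->
  weak_partial Omega i u v1 -> weak_partial Omega i u v2 ->
  ae_eq leb Omega v1 v2.
Proof.
move=> L1 L2_ w1 w2.
have : ae_eq leb Omega (fun x => -1 * v1 x + v2 x) (fun=> 0).
  apply: fundamental_lemma => //; first exact: L2_lin.
  move=> phi tphi; rewrite -/(L2dot _ _ _ _) L2dot_linl//; last exact: L2_test_function.
  have := w1 _ tphi; have := w2 _ tphi; rewrite /L2dot => -> /oppr_inj ->.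
  by ring.
apply: filterS => x h Ox; have := h Ox; lra.
Qed.

Lemma wpartial_ae_eq i u v : L2 leb Omega v -> weak_partial Omega i u v ->
  ae_eq leb Omega (wpartial Omega i u) v.
Proof.
move=> Lv uv; have wu := weak_partial_wpartial Lv uv.
exact: weak_partial_unique (L2_wpartial i u) Lv wu uv.
Qed.

Lemma W12_weak_partial i u : W12 Omega u -> weak_partial Omega i u (wpartial Omega i u).
Proof. by move=> [_ /(_ i)[v [Lv uv]]]; exact: weak_partial_wpartial uv. Qed.

Lemma W12_lin (c : R) u v : W12 Omega u -> W12 Omega v ->
  W12 Omega (fun x => c * u x + v x) /\
  forall i, ae_eq leb Omega (wpartial Omega i (fun x => c * u x + v x))
    (fun x => c * wpartial Omega i u x + wpartial Omega i v x).
Proof.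
move=> Wu Wv.
have LL i := L2_lin mO c (L2_wpartial i u) (L2_wpartial i v).
have W i : weak_partial Omega i (fun x => c * u x + v x)
    (fun x => c * wpartial Omega i u x + wpartial Omega i v x).
  apply: weak_partial_lin => //; try exact: L2_wpartial; try exact: W12_weak_partial.
  - by case: Wu.
  - by case: Wv.
split.
  split; first by apply: L2_lin; [|case: Wu|case: Wv].
  move=> i; exists (fun x => c * wpartial Omega i u x + wpartial Omega i v x).
  by split; [exact: LL|exact: W].
by move=> i; apply: wpartial_ae_eq; [exact: LL|exact: W].
Qed.

(** Carries derivatives from an explicit first derivative, such as a constant or a linear
    combination, to the representative [wpartial]; this is how the statements on second derivatives
    are reached. *)
Lemma W12_ae_eq u u' : L2 leb Omega u' -> ae_eq leb Omega u u' -> W12 Omega u ->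
  W12 Omega u' /\
  forall i, ae_eq leb Omega (wpartial Omega i u') (wpartial Omega i u).
Proof.
move=> Lu' uu' Wu.
have W i : weak_partial Omega i u' (wpartial Omega i u).
  apply: (weak_partial_ae_eq (v := wpartial Omega i u) oO bO _ Lu' _ _ uu').
  - by case: Wu.
  - exact: L2_wpartial.
  - exact: L2_wpartial.
  - exact: ae_eq_refl.
  - exact: W12_weak_partial.
split; last by move=> i; apply: wpartial_ae_eq; [exact: L2_wpartial|exact: W].
split => // i; exists (wpartial Omega i u); split; [exact: L2_wpartial|exact: W].
Qed.

Lemma W12_affine (a : R) b : W12 Omega (fun x => a + dot b x) /\
  forall i, ae_eq leb Omega (wpartial Omega i (fun x => a + dot b x)) (fun=> b ord0 i).
Proof.
have Lc (c : R) : L2 leb Omega (fun=> c) by apply: L2_cst => //; exact: bounded_open_finite.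
split.
  split; first exact: L2_affine.
  by move=> i; exists (fun=> b ord0 i); split => //; exact: weak_partial_affine.
by move=> i; apply: wpartial_ae_eq => //; exact: weak_partial_affine.
Qed.

Lemma W12_cst (c : R) : W12 Omega (fun=> c) /\
  forall i, ae_eq leb Omega (wpartial Omega i (fun=> c)) (fun=> 0).
Proof.
have := W12_affine c 0.
have -> : (fun x : 'rV[R]_n.+1 => c + dot 0 x) = (fun=> c).
  by apply/funext => x; rewrite /dot big1 ?addr0// => j _; rewrite mxE mul0r.
by move=> [W h]; split => // i; have := h i; rewrite mxE.
Qed.

Lemma W22_affine (a : R) b : W22 Omega (fun x => a + dot b x) /\
  forall i j, ae_eq leb Omega
    (wpartial Omega j (wpartial Omega i (fun x => a + dot b x))) (fun=> 0).
Proof.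
have [W h] := W12_affine a b.
have H i := W12_ae_eq (L2_wpartial i _) (ae_eq_sym (h i)) (W12_cst (b ord0 i)).1.
split; first by split; [exact: W|move=> i; exact: (H i).1].
move=> i j; apply: ae_eq_trans ((H i).2 j) _.
exact: (W12_cst (b ord0 i)).2.
Qed.

Lemma W22_lin (c : R) u v : W22 Omega u -> W22 Omega v ->
  W22 Omega (fun x => c * u x + v x) /\
  forall i j, ae_eq leb Omega
    (wpartial Omega j (wpartial Omega i (fun x => c * u x + v x)))
    (fun x => c * wpartial Omega j (wpartial Omega i u) x
              + wpartial Omega j (wpartial Omega i v) x).
Proof.
move=> [Wu Wdu] [Wv Wdv].
have [W h] := W12_lin c Wu Wv.
have L i := W12_lin c (Wdu i) (Wdv i).
have H i := W12_ae_eq (L2_wpartial i _) (ae_eq_sym (h i)) (L i).1.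
split; first by split; [exact: W|move=> i; exact: (H i).1].
by move=> i j; apply: ae_eq_trans ((H i).2 j) _; exact: (L i).2.
Qed.

Lemma hess_sq_integrable u : leb.-integrable Omega (EFin \o hess_sq Omega u) /\
  \int[leb]_(x in Omega) hess_sq Omega u x =
  \sum_i \sum_j nsq (wpartial Omega j (wpartial Omega i u)).
Proof.
have h i := @Rintegral_sum _ _ leb Omega mO _ (index_enum 'I_n.+1)
  (fun j x => wpartial Omega j (wpartial Omega i u) x ^+ 2)
  (fun j => L2_sqr_integrable mO (L2_wpartial j _)).
have [I E] := @Rintegral_sum _ _ leb Omega mO _ (index_enum 'I_n.+1) _ (fun i => (h i).1).
split; first exact: I.
rewrite [LHS]E; apply: eq_bigr => i _; rewrite (h i).2.
by apply: eq_bigr => j _; apply: eq_Rintegral => x _; rewrite expr2.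
Qed.

Lemma sqr_hess_norm u : hess_norm Omega u ^+ 2 =
  \sum_i \sum_j nsq (wpartial Omega j (wpartial Omega i u)).
Proof.
rewrite sqr_sqrtr; first by have [] := hess_sq_integrable u.
apply: Rintegral_ge0 => x _; apply: sumr_ge0 => i _.
by apply: sumr_ge0 => j _; exact: sqr_ge0.
Qed.

Lemma grad_sq_integrable u : leb.-integrable Omega (EFin \o grad_sq Omega u) /\
  \int[leb]_(x in Omega) grad_sq Omega u x = \sum_i nsq (wpartial Omega i u).
Proof.
have [I E] := @Rintegral_sum _ _ leb Omega mO _ (index_enum 'I_n.+1)
  (fun i x => wpartial Omega i u x ^+ 2) (fun i => L2_sqr_integrable mO (L2_wpartial i u)).
split; first exact: I.
rewrite [LHS]E.
by apply: eq_bigr => i _; apply: eq_Rintegral => x _; rewrite expr2.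
Qed.

Lemma sqr_grad_norm u :
  grad_norm Omega u ^+ 2 = \sum_i nsq (wpartial Omega i u).
Proof.
rewrite sqr_sqrtr; first by have [] := grad_sq_integrable u.
by apply: Rintegral_ge0 => x _; apply: sumr_ge0 => i _; exact: sqr_ge0.
Qed.

Lemma W12normE u : L2 leb Omega u ->
  W12norm Omega u = Num.sqrt (nsq u + \sum_i nsq (wpartial Omega i u)).
Proof.
move=> Lu; have [I E] := grad_sq_integrable u.
congr Num.sqrt; rewrite RintegralD//; last exact: L2_sqr_integrable.
by rewrite E; congr (_ + _); apply: eq_Rintegral => x _; rewrite expr2.
Qed.

Lemma W22normE u : L2 leb Omega u ->
  W22norm Omega u = Num.sqrt (nsq u + \sum_i nsq (wpartial Omega i u) +
    \sum_i \sum_j nsq (wpartial Omega j (wpartial Omega i u))).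
Proof.
move=> Lu; have [I E] := grad_sq_integrable u; have [I2 E2] := hess_sq_integrable u.
have i1 := L2_sqr_integrable mO Lu.
congr Num.sqrt; rewrite RintegralD//; last first.
  by have := integrableD mO i1 I; apply: eq_integrable.
rewrite RintegralD// E E2; congr (_ + _ + _).
Qed.

Lemma W12norm_le_W22norm u : L2 leb Omega u -> W12norm Omega u <= W22norm Omega u.
Proof.
move=> Lu; rewrite W12normE// W22normE//; apply: ler_wsqrtr; rewrite lerDl.
by apply: sumr_ge0 => i _; apply: sumr_ge0 => j _; exact: L2dot_ge0.
Qed.

(** Indexing all derivatives of order at most two by one finite type turns the norm of [W22] into
    that of a single family, ready for Minkowski. *)
Definition jet u (k : unit + ('I_n.+1 + 'I_n.+1 * 'I_n.+1)) : 'rV[R]_n.+1 -> R :=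
  match k with
  | inl _ => u
  | inr (inl i) => wpartial Omega i u
  | inr (inr ij) => wpartial Omega ij.2 (wpartial Omega ij.1 u)
  end.

Lemma L2_jet u k : L2 leb Omega u -> L2 leb Omega (jet u k).
Proof. by case: k => [[]|[i|[i j]]] //= _; exact: L2_wpartial. Qed.

Lemma W22norm_jet u : L2 leb Omega u ->
  W22norm Omega u = Num.sqrt (\sum_k nsq (jet u k)).
Proof.
move=> Lu; rewrite W22normE// !big_sumType /= (big_pred1 tt) => [|[]//].
by rewrite pair_big /= addrA.
Qed.

Lemma W22norm_sub u v : W22 Omega u -> W22 Omega v ->
  W22norm Omega (fun x => u x - v x) <= W22norm Omega u + W22norm Omega v.
Proof.
move=> Wu Wv; have Lu := Wu.1.1; have Lv := Wv.1.1.
have E : (fun x => u x - v x) = (fun x => -1 * v x + u x).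
  by apply/funext => x; ring.
have [W h2] := W22_lin (-1) Wv Wu.
have [_ h1] := W12_lin (-1) Wv.1 Wu.1.
rewrite E !W22norm_jet//; last exact: W.1.1.
apply: minkowski_family_sub => // [k|k|k|k]; try exact: L2_jet.
  by apply: L2_jet; exact: W.1.1.
case: k => [[]|[i|[i j]]]; [exact: ae_eq_refl|exact: h1|exact: h2].
Qed.

End sobolev_linear.

(** * Affine approximation and the trace *)

Section affine_approximation.
Context {R : realType} {n : nat}.
Variables (Omega : set 'rV[R]_n.+1) (Q : R).
Hypotheses (oO : open Omega) (bO : bounded_set Omega) (Q0 : 0 < Q).
Local Notation leb := (@lebesgue_rV R n.+1).
Local Notation nsq u := (L2dot leb Omega u u).
Hypothesis poincare : forall u, W12 Omega u ->
  L2norm leb Omega (fun x => u x - mean Omega u) <= Q * grad_norm Omega u.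

Let mO : measurable Omega. Proof. exact: measurable_open. Qed.

(** The squared form can be summed over the components of the gradient. *)
Lemma poincare_sqr u : W12 Omega u ->
  nsq (fun x => -1 * mean Omega u + u x) <= Q ^+ 2 * \sum_i nsq (wpartial Omega i u).
Proof.
move=> Wu; rewrite -sqr_grad_norm// -sqr_L2norm -exprMn.
rewrite lerXn2r ?nnegrE ?sqrtr_ge0//; first by rewrite mulr_ge0 ?sqrtr_ge0// ltW.
rewrite (_ : (fun x => _) = (fun x => u x - mean Omega u)); first exact: poincare.
by apply/funext => x; ring.
Qed.

(** Here [x], [y], [h] stand for the squared norms of the function, its gradient and its Hessian;
    this is the origin of [1 + Q^2 + Q^4]. *)
Lemma poincare_chain (x y h : R) : x <= Q ^+ 2 * y -> y <= Q ^+ 2 * h ->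
  x + y + h <= (1 + Q ^+ 2 + Q ^+ 4) * h.
Proof.
move=> xy yh; have : Q ^+ 2 * y <= Q ^+ 4 * h.
  by rewrite (exprD Q 2 2) -mulrA ler_wpM2l// sqr_ge0.
by rewrite !mulrDl mul1r; lra.
Qed.

(* The slope is the mean of the gradient, and the constant is then the mean of
   what remains. *)
Lemma affine_approximation u : W22 Omega u ->
  exists a b, let v := fun x => -1 * (a + dot b x) + u x in
    W22 Omega v /\
    W22norm Omega v <= Num.sqrt (1 + Q ^+ 2 + Q ^+ 4) * hess_norm Omega u.
Proof.
move=> Wu; have [Wu1 Wp] := Wu.
pose p i := wpartial Omega i u.
pose b : 'rV[R]_n.+1 := \row_i mean Omega (p i).
(* Only the slope is removed here; the [0 +] keeps the form of an affine function with zero constant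
   term. *)
pose v1 x := -1 * (0 + dot b x) + u x.
pose a := mean Omega v1.
have Lp i : L2 leb Omega (p i) by exact: L2_wpartial.
have Lc (c : R) : L2 leb Omega (fun=> c) by apply: L2_cst => //; exact: bounded_open_finite.
have Lpb i : L2 leb Omega (fun x => -1 * mean Omega (p i) + p i x) by exact: L2_lin.
have [Aa Ha] := W12_affine oO bO a b; have [A0 H0] := W12_affine oO bO 0 b.
have [A2 H2] := W22_affine oO bO a b.
have [Wv1 dv1] := W12_lin oO bO (-1) A0 Wu1.
have [Wv dv] := W12_lin oO bO (-1) Aa Wu1.
have [W2v ddv] := W22_lin oO bO (-1) A2 Wu.
exists a, b; split; first exact: W2v.
set v := fun x => _.
(* [v1] and [v] differ by a constant, so both have a.e. the gradient of [u] minus its mean. *)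
have E1 i : nsq (wpartial Omega i v1) = nsq (fun x => -1 * mean Omega (p i) + p i x).
  apply: L2dot_ae_eq => //; first exact: L2_wpartial.
  apply: ae_eq_trans (dv1 i) _; apply: filterS (H0 i) => x h Ox.
  by rewrite h// mxE.
have E2 i : nsq (wpartial Omega i v) = nsq (fun x => -1 * mean Omega (p i) + p i x).
  apply: L2dot_ae_eq => //; first exact: L2_wpartial.
  apply: ae_eq_trans (dv i) _; apply: filterS (Ha i) => x h Ox.
  by rewrite h// mxE.
have E3 i j : nsq (wpartial Omega j (wpartial Omega i v)) = nsq (wpartial Omega j (p i)).
  apply: L2dot_ae_eq => //; try exact: L2_wpartial.
  apply: ae_eq_trans (ddv i j) _; apply: filterS (H2 i j) => x h Ox.
  by rewrite h// mulr0 add0r.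
have E4 : nsq v = nsq (fun x => -1 * mean Omega v1 + v1 x).
  by apply: eq_Rintegral => x _; rewrite /v /v1 -/a; ring.
rewrite W22normE//; last exact: Wv.1.
have hH : 0 <= hess_norm Omega u by exact: sqrtr_ge0.
rewrite -[hess_norm _ _]ger0_norm// -sqrtr_sqr -sqrtrM; last first.
  by rewrite !addr_ge0// exprn_ge0// ltW.
apply: ler_wsqrtr; rewrite (sqr_hess_norm oO).
have B1 : \sum_i nsq (wpartial Omega i v1) <=
    Q ^+ 2 * \sum_i \sum_j nsq (wpartial Omega j (p i)).
  rewrite mulr_sumr; apply: ler_sum => i _.
  by apply: le_trans (poincare_sqr (Wp i)); rewrite (E1 i).
have B2 : nsq v <= Q ^+ 2 * \sum_i nsq (wpartial Omega i v1).
  by apply: le_trans (poincare_sqr Wv1); rewrite E4.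
have B3 : \sum_i nsq (wpartial Omega i v) = \sum_i nsq (wpartial Omega i v1).
  by apply: eq_bigr => i _; exact: etrans (E2 i) (esym (E1 i)).
have B4 : \sum_i \sum_j nsq (wpartial Omega j (wpartial Omega i v)) =
    \sum_i \sum_j nsq (wpartial Omega j (p i)).
  by apply: eq_bigr => i _; apply: eq_bigr => j _; exact: E3.
have eqW (x y : R) : x = y -> x <= y by move=> ->.
apply: le_trans (poincare_chain B2 B1).
by apply: lerD (eqW _ _ B4); exact: lerD (lexx _) (eqW _ _ B3).
Qed.

End affine_approximation.

Section affine_space.
Context {R : realType} {n : nat}.

Lemma affine_fun_lin (c : R) (w1 w2 : 'rV[R]_n.+1 -> R) :
  affine_fun w1 -> affine_fun w2 -> affine_fun (fun x => c * w1 x + w2 x).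
Proof.
move=> [a1 [b1 ->]] [a2 [b2 ->]]; exists (c * a1 + a2), (c *: b1 + b2).
by apply/funext => x; rewrite dot_linl; ring.
Qed.

Lemma affine_fun_cst (c : R) : affine_fun (fun _ : 'rV[R]_n.+1 => c).
Proof.
exists c, 0; apply/funext => x.
by rewrite /dot big1 ?addr0// => j _; rewrite mxE mul0r.
Qed.

Lemma measurable_open_portion (Omega Gamma : set 'rV[R]_n.+1) :
  open_portion Omega Gamma -> measurable Gamma.
Proof.
move=> [_ [U oU ->]]; apply: measurableI; first exact: measurable_open.
apply: measurableD; first by apply: measurable_closed; exact: closed_closure.
by apply: measurable_open; exact: open_interior.
Qed.

End affine_space.

(** * Projection onto the affine traces and the norm of their inverse *)

Section trace_projection.
Context {R : realType} {n : nat}.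
Variables (Omega Gamma : set 'rV[R]_n.+1)
  (gamma e proj : ('rV[R]_n.+1 -> R) -> ('rV[R]_n.+1 -> R)).
Hypotheses (oO : open Omega) (bO : bounded_set Omega) (mG : measurable Gamma).
Hypotheses (trG : trace_operator Omega Gamma gamma)
  (einv : affine_trace_inverse Gamma gamma e)
  (projG : orthogonal_projection Gamma gamma proj).
Implicit Types (u v w : 'rV[R]_n.+1 -> R).
Local Notation S := (@surface R n).
Local Notation LG := (L2 S Gamma).
Local Notation dotG := (L2dot S Gamma).

Let traceL2 u : W12 Omega u -> LG (gamma u).
Proof. by have [h _ _ _] := trG; exact: h. Qed.

Let trace_lin (c : R) u v : W12 Omega u -> W12 Omega v ->
  ae_eq S Gamma (gamma (fun x => c * u x + v x)) (fun x => c * gamma u x + gamma v x).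
Proof. by have [_ h _ _] := trG; exact: h. Qed.

Lemma affine_W22 w : affine_fun w -> W22 Omega w.
Proof. by move=> [a [b ->]]; exact: (W22_affine oO bO a b).1. Qed.

Lemma affine_W12 w : affine_fun w -> W12 Omega w.
Proof. by move=> /affine_W22[]. Qed.

Lemma trace_affine w : affine_fun w -> ae_eq S Gamma (gamma w) w.
Proof.
move=> Aw; have [_ _ _ h] := trG; apply: h; first exact: affine_W12.
apply: continuous_subspaceT; move: Aw => [a [b ->]].
exact: continuous_affine.
Qed.

Lemma affine_traces_gamma w : affine_fun w -> affine_traces Gamma gamma (gamma w).
Proof.
move=> Aw; split; first by apply: traceL2; exact: affine_W12.
by exists w => //; exact: ae_eq_refl.
Qed.

Lemma affine_inverseP g : affine_traces Gamma gamma g ->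
  affine_fun (e g) /\ ae_eq S Gamma g (gamma (e g)).
Proof. by move=> /einv h; exact: (h (e g)).1 erefl. Qed.

Lemma affine_inverse_unique g w : affine_traces Gamma gamma g ->
  affine_fun w -> ae_eq S Gamma g (gamma w) -> e g = w.
Proof. by move=> /einv h Aw gw; apply: (h w).2. Qed.

Lemma affine_traces_lin (c : R) g1 g2 : affine_traces Gamma gamma g1 ->
  affine_traces Gamma gamma g2 ->
  affine_traces Gamma gamma (fun x => c * g1 x + g2 x).
Proof.
move=> [L1 [w1 A1 E1]] [L2_ [w2 A2 E2]]; split; first exact: L2_lin.
exists (fun x => c * w1 x + w2 x); first exact: affine_fun_lin.
have := trace_lin c (affine_W12 A1) (affine_W12 A2) => E.
apply: filterS3 E1 E2 E => x h1 h2 h Gx.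
by rewrite h1// h2// h.
Qed.

(** [opnorm] ranges over traces of nonzero norm; this settles the remaining ones. *)
Lemma affine_inverse_eq0 g : affine_traces Gamma gamma g ->
  ae_eq S Gamma g (fun=> 0) -> e g = (fun=> 0).
Proof.
move=> Ag g0; apply: affine_inverse_unique => //; first exact: affine_fun_cst.
exact: ae_eq_trans g0 (ae_eq_sym (trace_affine (affine_fun_cst 0))).
Qed.

(** Otherwise [e] would send this trace both to 0 and to 1. The lemma makes the supremum in [opnorm]
    range over a nonempty set and forces [C_Gamma] to be positive. *)
Lemma trace_one_neq0 : L2norm S Gamma (gamma (fun=> 1)) != 0.
Proof.
have A1 : affine_fun (fun _ : 'rV[R]_n.+1 => 1 : R) := affine_fun_cst 1.
have T1 := affine_traces_gamma A1.
apply/negP => /eqP /(congr1 (fun t => t ^+ 2)); rewrite sqr_L2norm expr0n /=.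
move=> /(L2dot_eq0 mG T1.1) /(affine_inverse_eq0 T1) e0.
have e1 := affine_inverse_unique T1 A1 (ae_eq_refl _ _ _).
have := congr1 (fun f => f 0) (etrans (esym e1) e0).
by move/eqP; rewrite oner_eq0.
Qed.

Lemma opnorm_ub g : affine_traces Gamma gamma g -> L2norm S Gamma g != 0 ->
  ((W22norm Omega (e g) / L2norm S Gamma g)%:E <= opnorm Omega Gamma gamma e)%E.
Proof. by move=> Tg g0; apply: ereal_sup_ubound; exists g. Qed.

Lemma opnorm_ge0 : (0 <= opnorm Omega Gamma gamma e)%E.
Proof.
have T1 := affine_traces_gamma (affine_fun_cst 1).
apply: le_trans (opnorm_ub T1 trace_one_neq0).
by rewrite lee_fin divr_ge0 ?sqrtr_ge0.
Qed.

(** Pythagoras: the residual is orthogonal to [proj g], so its squared norm is the difference of the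
    two squared norms. *)
Lemma projection_contraction g : LG g ->
  L2norm S Gamma (proj g) <= L2norm S Gamma g.
Proof.
move=> Lg; have [Tp orth] := projG Lg; have Lp := Tp.1.
have Lgp := L2_sub mG Lg Lp.
rewrite !L2normE; apply: ler_wsqrtr.
have E : (fun x => g x - proj g x) = (fun x => -1 * proj g x + g x).
  by apply/funext => x; ring.
have := orth _ Tp; have := L2dot_ge0 S Gamma (fun x => g x - proj g x).
rewrite E !(L2dot_linl mG _ _ _ _)//; last by rewrite -E.
rewrite !(L2dot_linr mG _ _ _ _)// (L2dotC _ _ (proj g) g); lra.
Qed.

(* [k := proj (gamma u) - proj (gamma v) - gamma w] is an affine trace and the
   difference of two residuals, so it is orthogonal to itself. *)
Lemma affine_projection_add u w : W12 Omega u -> affine_fun w ->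
  let v := fun x => -1 * w x + u x in
  e (proj (gamma u)) = (fun x => e (proj (gamma v)) x + w x).
Proof.
move=> Wu Aw v; have Ww := affine_W12 Aw.
have Wv : W12 Omega v := (W12_lin oO bO (-1) Ww Wu).1.
have Gv := trace_lin (-1) Ww Wu.
have Lu := traceL2 Wu; have Lv := traceL2 Wv; have Lw := traceL2 Ww.
have [Tu ou] := projG Lu; have [Tv ov] := projG Lv.
set pu := proj (gamma u) in Tu ou *; set pv := proj (gamma v) in Tv ov *.
have Tw := affine_traces_gamma Aw.
pose k x := -1 * (1 * pv x + gamma w x) + pu x.
have Tk : affine_traces Gamma gamma k.
  by apply: affine_traces_lin => //; exact: affine_traces_lin.
have Lk := Tk.1.
have Lru := L2_sub mG Lu Tu.1; have Lrv := L2_sub mG Lv Tv.1.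
(* Substituting [gamma v = gamma u - gamma w], valid a.e., makes [gamma w] disappear in favour of
   the residuals. *)
have kE : ae_eq S Gamma k (fun x => -1 * (gamma u x - pu x) + (gamma v x - pv x)).
  by apply: filterS Gv => x h Gx; rewrite /k /v h//; ring.
have kk : dotG k k = 0.
  rewrite (L2dot_ae_eql mG Lk _ Lk kE); last exact: L2_lin.
  by rewrite L2dot_linl// ou// ov// mulr0 addr0.
have k0 := L2dot_eq0 mG Lk kk.
have [Av Ev] := affine_inverseP Tv.
have -> : (fun x => e pv x + w x) = (fun x => 1 * e pv x + w x).
  by apply/funext => x; rewrite mul1r.
(* [k = 0] reads [pu = pv + gamma w], and the right side is a.e. the trace of [e pv + w]. *)
apply: affine_inverse_unique => //; first exact: affine_fun_lin.
have Gl := trace_lin 1 (affine_W12 Av) Ww.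
apply: filterS3 k0 Ev Gl => x h1 h2 h3 Gx.
by rewrite h3// -h2//; have := h1 Gx; rewrite /k; lra.
Qed.

End trace_projection.

Theorem theorem4p7 (R : realType) (n : nat)
    (Omega Gamma : set 'rV[R]_n.+1) (Q C_Gamma : R)
    (gamma e proj : ('rV[R]_n.+1 -> R) -> ('rV[R]_n.+1 -> R)) :
  open Omega -> connected Omega -> bounded_set Omega ->
  lipschitz_boundary Omega ->
  open_portion Omega Gamma ->
  ~ in_hyperplane Gamma ->
  0 < Q ->
  (forall u, W12 Omega u ->
    L2norm (lebesgue_rV n.+1) Omega (fun x => u x - mean Omega u)
      <= Q * grad_norm Omega u) ->
  trace_operator Omega Gamma gamma ->
  (forall u, W12 Omega u ->
    L2norm surface Gamma (gamma u) <= C_Gamma * W12norm Omega u) ->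
  affine_trace_inverse Gamma gamma e ->
  orthogonal_projection Gamma gamma proj ->
  let tau := e \o proj in
  forall u, W22 Omega u ->
    ((W22norm Omega (fun x => u x - tau (gamma u) x))%:E
     <= (1 + C_Gamma%:E * opnorm Omega Gamma gamma e)
        * (Num.sqrt (1 + Q ^+ 2 + Q ^+ 4))%:E
        * (hess_norm Omega u)%:E)%E.
Proof.
move=> oO _ bO _ opG _ Q0 poincare trG traceC einv projG tau u Wu.
have mG := measurable_open_portion opG.
have [a [b]] := affine_approximation oO bO Q0 poincare Wu.
set v := fun x => _; move=> [Wv Nv].
pose w := fun x : 'rV[R]_n.+1 => a + dot b x.
have Aw : affine_fun w by exists a, b.
have tauE := affine_projection_add oO bO mG trG einv projG Wu.1 Aw.
set s := Num.sqrt _ in Nv *; set H := hess_norm _ _ in Nv *.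
have s0 : 0 <= s by exact: sqrtr_ge0.
have H0 : 0 <= H by exact: sqrtr_ge0.
set E := opnorm _ _ _ _.
have E0 : (0 <= E)%E := opnorm_ge0 oO bO mG trG einv.
(* The trace bound at the constant function 1, whose trace has positive norm. The sign is needed to
   multiply inequalities by [C_Gamma]. *)
have C0 : 0 < C_Gamma.
  have A1 : affine_fun (fun _ : 'rV[R]_n.+1 => 1 : R) := affine_fun_cst 1.
  have := traceC _ (affine_W12 oO bO A1).
  have : 0 < L2norm surface Gamma (gamma (fun=> 1)).
    by rewrite lt_def sqrtr_ge0 andbT; exact: trace_one_neq0 oO bO mG trG einv.
  move=> /lt_le_trans /[apply] h; rewrite ltNge; apply/negP => C0.
  by move: h; rewrite ltNge mulr_le0_ge0// sqrtr_ge0.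
have Lgv : L2 surface Gamma (gamma v) by have [h _ _ _] := trG; apply: h; exact: Wv.1.
have [Tv _] := projG _ Lgv.
set pv := proj (gamma v) in Tv.
have Pv : L2norm surface Gamma pv <= C_Gamma * (s * H).
  apply: le_trans (projection_contraction mG projG Lgv) _.
  apply: le_trans (traceC _ Wv.1) _; apply: ler_wpM2l; first exact: ltW.
  by apply: le_trans Nv; apply: W12norm_le_W22norm => //; exact: Wv.1.1.
(* [B] bounds the norm of [e pv]. If [pv] has norm 0, the quotient in [opnorm] says nothing, but
   then [e pv] is the zero function and [B = 0] works, even against an infinite [E] since
   [E * 0 = 0]. *)
have [B hB BE] : exists2 B : R, W22norm Omega (fun x => u x - tau (gamma u) x) <=
    W22norm Omega v + B & (B%:E <= E * (L2norm surface Gamma pv)%:E)%E.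
  (* [u = v + w] and [tau (gamma u) = e pv + w], so [w] cancels. *)
  have EE : (fun x => u x - tau (gamma u) x) = (fun x => v x - e pv x).
    by apply/funext => x; rewrite /tau /= tauE -/pv /v /w; ring.
  rewrite EE; have [P0|P0] := eqVneq (L2norm surface Gamma pv) 0.
    exists 0; last by rewrite P0 mule0.
    rewrite (affine_inverse_eq0 oO bO trG einv Tv).
      by rewrite addr0; under [X in W22norm _ X]eq_fun do rewrite subr0.
    by apply: L2dot_eq0 Tv.1 _ => //; rewrite -sqr_L2norm P0 expr0n.
  exists (W22norm Omega (e pv)).
    apply: (W22norm_sub oO bO Wv); apply: (affine_W22 oO bO).
    by have [] := affine_inverseP einv Tv.
  have Pp : 0 < L2norm surface Gamma pv by rewrite lt_def P0 sqrtr_ge0.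
  rewrite -[leLHS](_ : ((W22norm Omega (e pv) / L2norm surface Gamma pv)%:E *
     (L2norm surface Gamma pv)%:E)%E = _); last by rewrite -EFinM divfK.
  apply: lee_wpmul2r; first by rewrite lee_fin ltW.
  exact: opnorm_ub.
apply: (@le_trans _ _ ((s * H)%:E + E * (C_Gamma * (s * H))%:E)%E).
  apply: (@le_trans _ _ (W22norm Omega v + B)%:E); first by rewrite lee_fin.
  rewrite EFinD; apply: leeD; first by rewrite lee_fin.
  by apply: le_trans BE _; apply: lee_wpmul2l => //; rewrite lee_fin.
(* As [E] is an extended real, distributivity is justified by the signs of 1 and [C_Gamma * E]. *)
rewrite -muleA -EFinM ge0_muleDl//; last by rewrite mule_ge0// lee_fin ltW.
by rewrite mul1e [(C_Gamma * _)%:E]EFinM muleA [(E * C_Gamma%:E)%E]muleC.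
Qed.
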